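(* For a single server system under the last come first serve scheduling policy with preemptive service (LCFSp), Poisson update generation at rate $\lambda$, and service times with fixed mean $1/\mu$, $\lambda<\mu$, deterministic service yields the worst case average age: for every service time distribution $F_S$ with mean $1/\mu$, $$A^{\mathrm{ave}}_{\mathrm{M/G/1}}\ \le\ A^{\mathrm{ave}}_{\mathrm{M/D/1}},$$ where $A^{\mathrm{ave}}_{\mathrm{M/G/1}}$ is the average age under service distribution $F_S$ and $A^{\mathrm{ave}}_{\mathrm{M/D/1}}$ is the average age under deterministic service $S=1/\mu$ almost surely.
   Context: Update packets $i=1,2,\dots$ are generated at times $t_1<t_2<\cdots$ of a Poisson process of rate $\lambda$. Service times are i.i.d. with distribution $F_S$, independent of the generation process. There is one server, serving one packet at a time; under LCFSp a newly generated packet immediately preempts any packet in service, so packet $i$ (with service time $S_i$) completes service before the next generation, $X_i$ time units later, if and only if $S_i<X_i$; preempted packets are not dropped but when delivered later they carry stale information. If packet $i$ reaches the destination at time $t_i'$ and $\mathcal{P}(t)$ is the set of packets received up to time $t$, the age is $A(t)=\min_{i\in\mathcal{P}(t)}(t-t_i)$ and the average age is $A^{\mathrm{ave}}=\limsup_{T\to\infty}\mathbb{E}\left[\frac1T\int_0^TA(t)\,dt\right]$. *)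

(* Defs.v *)
From HB Require Import structures.
From mathcomp Require Import all_boot all_order all_algebra.
From mathcomp Require Import all_classical all_reals all_analysis.

Set Implicit Arguments.
Unset Strict Implicit.
Unset Printing Implicit Defensive.

Import Order.TTheory GRing.Theory Num.Theory.
Import numFieldNormedType.Exports.

Local Open Scope classical_set_scope.
Local Open Scope ring_scope.

(* Packets are numbered from 0.  In [sample_path], [gen i] and [service i] are
   the generation time and the service time of packet i, and [sigma u] is the
   packet being served at time u ([None] when the server is idle); they are
   the values of the random quantities at one outcome. *)
Section sample_path.
Context {R : realType}.
Variables (gen service : nat -> R) (sigma : R -> option nat).

Definition attained_service (i : nat) (u : R) : \bar R :=
  lebesgue_measure [set s | 0 <= s <= u /\ sigma s = Some i].

(* Packet i is received as soon as the server has spent a total time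
   [service i] on it, possibly in several pieces. *)
Definition received (u : R) : set nat :=
  [set i | gen i <= u /\ ((service i)%:E <= attained_service i u)%E].

Definition in_system (u : R) : set nat :=
  [set i | gen i <= u /\ (attained_service i u < (service i)%:E)%E].

(* Last come first serve with preemption: the server always works on the most
   recently generated packet present.  A preempted packet stays in the system
   and its service is resumed later. *)
Definition lcfsp : Prop :=
  forall u i, 0 <= u ->
    sigma u = Some i <->
    in_system u i /\ (forall j, in_system u j -> (j <= i)%N).

(* The destination is assumed to hold an update generated at time 0, so that
   the age is u until the first reception; without such a convention the
   minimum ranges over the empty set. *)
Definition age (u : R) : \bar R :=
  Order.min u%:E (ereal_inf [set (u - gen i)%:E | i in received u]).

End sample_path.

Section random_model.
Context {d : measure_display} {T : measurableType d} {R : realType}.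
Variable P : probability T R.

Definition has_law (X : T -> R) (law : set R -> \bar R) : Prop :=
  forall A : set R, measurable A -> P (X @^-1` A) = law A.

Definition mutually_independent (I : eqType) (X : I -> T -> R) : Prop :=
  forall (s : seq I) (B : I -> set R), uniq s ->
    (forall i, measurable (B i)) ->
    P [set w | forall i, i \in s -> B i (X i w)] =
    (\prod_(i <- s) P (X i @^-1` B i))%E.

(* [interarrival gen 0] is the waiting time from time 0 to the first packet. *)
Definition interarrival (gen : nat -> T -> R) (i : nat) (w : T) : R :=
  if i is k.+1 then gen k.+1 w - gen k w else gen 0%N w.

Definition poisson_process (rate : R) (gen : nat -> T -> R) : Prop :=
  (forall i, has_law (interarrival gen i) (exponential_prob rate)) /\
  mutually_independent (interarrival gen).

Definition iid (law : set R -> \bar R) (X : nat -> T -> R) : Prop :=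
  (forall i, has_law (X i) law) /\ mutually_independent X.

(* The last independence clause, on the joint family, makes the service times
   independent of the generation process. *)
Definition MG1_lcfsp (rate : R) (law : set R -> \bar R)
    (gen service : nat -> {RV P >-> R}) (sigma : R -> T -> option nat) : Prop :=
  [/\ poisson_process rate gen,
      iid law service,
      mutually_independent (fun k : nat + nat =>
        match k with
        | inl i => interarrival gen i
        | inr i => service i : T -> R
        end) &
      {ae P, forall w, lcfsp (gen ^~ w) (service ^~ w) (sigma ^~ w)}].

(* Expectations are written as integrals because the age is valued in
   [\bar R]. *)
Definition average_age (gen service : nat -> T -> R)
    (sigma : R -> T -> option nat) : \bar R :=
  limf_esup (fun tau : R =>
    (\int[P]_w ((tau^-1)%:E *
       \int[lebesgue_measure]_(u in `[0%R, tau])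
          age (gen ^~ w) (service ^~ w) (sigma ^~ w) u))%E)
    (pinfty_nbhs R).

End random_model.

(* Main.v *)
(** Only packets delivered before the next generation matter: the age at time
    [u] is [u] minus the generation time of the freshest of them, so that it is
    determined by the time since the last generation and by the age [Z k] just
    before each generation [t k], where [Z k.+1] is the interarrival time
    [X k.+1], plus [Z k] when packet [k] is preempted.  By memorylessness of the
    interarrival times, the expected integral of the age over [[0, tau]] is
    [lambda^-1] times the expected sum of the [Z k] with [t k <= tau].  The
    recursion [E Z_{k+1} = 1 / lambda + P (X < S) E Z_k] gives the average age
    [1 / (lambda E [exp (- lambda S)])], which by Jensen's inequality is largest
    when [S] is constant.  The upper bound is obtained at each [tau] from the
    recursion restricted to [t k <= tau]; for the lower bound, where this
    truncation loses a term, [tau] is replaced by an exponential time of rate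
    [eps], for which the recursion is exact, and [eps] tends to 0. *)

Require Import Defs.
From HB Require Import structures.
From mathcomp Require Import all_boot all_order all_algebra.
From mathcomp Require Import all_classical all_reals all_analysis.
From mathcomp Require Import measurable_realfun measurable_fun_approximation.
From mathcomp Require Import ring lra.
Import Order.TTheory GRing.Theory Num.Theory.
Import numFieldNormedType.Exports.
Local Open Scope classical_set_scope.
Local Open Scope ring_scope.

(** The general law needs only an upper bound and the deterministic law only a lower one, so Jensen
    enters once, as a bound on the preemption probability. The indicator of [gen k.+1 <= tau] does
    not split over the interarrival times, whereas [exp (- eps * gen k.+1)] does; hence the exact
    recursion for exponential times. No Tauberian theorem is required to return to time averages:
    with [a] the generation rate, if the averages beyond some [K] are at most [c], the expected sum
    of peaks up to [tau] is at most linear in [tau], and its exponential mixture is at most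
    [a * c * (K + 1 / eps)]; the recursion makes the same mixture at least about [1 / (eps * p)],
    where [p] is the probability of no preemption. Comparing the coefficients of [1 / eps] gives
    [1 / (a * p) <= c]. Sums may a priori be infinite, so nothing is subtracted before finiteness is
    known: the upper bound runs by induction on partial sums, and the lower bound gets finiteness
    from [c]. *)

Section nonmeasurable_integrands.
Local Open Scope ereal_scope.
Context {d : measure_display} {T : measurableType d} {R : realType}.
Variable m : {measure set T -> \bar R}.

(* On the exceptional null set [sigma] is arbitrary, so the age need not be
   measurable: these comparisons hold because [integral] is a supremum over the
   simple functions below the integrand. *)
Lemma ge0_le_integral_nonmeasurable (D : set T) (f g : T -> \bar R) :
  (forall x, D x -> 0 <= f x) -> (forall x, D x -> f x <= g x) ->
  \int[m]_(x in D) f x <= \int[m]_(x in D) g x.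
Proof.
move=> f0 fg; rewrite !ge0_integralE//; last first.
  by move=> x Dx; apply: le_trans (fg _ Dx); exact: f0.
apply: ge_ereal_sup => _ [h hf <-]; apply: ereal_sup_ubound; exists h => //.
move=> x; apply: le_trans (hf x) _; rewrite !patchE; case: ifPn => //.
by rewrite inE; exact: fg.
Qed.

(** [f] is squeezed between two measurable modifications of [g], set to 0 and to [+oo] on the null
    set; both have the integral of [g]. *)
Lemma ge0_ae_eq_integral_nonmeasurable (f g : T -> \bar R) :
  measurable_fun setT g -> (forall x, 0 <= f x) -> (forall x, 0 <= g x) ->
  {ae m, forall x, f x = g x} -> \int[m]_x f x = \int[m]_x g x.
Proof.
move=> mg f0 g0 [N [mN N0 fgN]].
have fgE x : ~ N x -> f x = g x by apply: contra_notP; exact: fgN.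
pose h (c : \bar R) x := if x \in N then c else g x.
have mh c : measurable_fun setT (h c).
  apply: measurable_fun_ifT => //.
  by apply: (measurable_fun_bool true) => //; rewrite setTI preimage_mem_true.
have hg c : 0 <= c -> \int[m]_x h c x = \int[m]_x g x.
  move=> c0; apply: ge0_ae_eq_integral => //.
    by move=> x _; rewrite /h; case: ifP.
  exists N; split => // x /=; apply: contra_notP => Nx _.
  by rewrite /h memNset.
apply/eqP; rewrite eq_le -{1}(hg +oo)// -{1}(hg 0)//.
apply/andP; split; apply: ge0_le_integral_nonmeasurable => // x _; rewrite /h.
- by case: ifPn => [_|/negP xN]; [rewrite leey | rewrite fgE// => /mem_set].
- by case: ifP.
- by case: ifPn => [_//|/negP xN]; rewrite fgE// => /mem_set.
Qed.

End nonmeasurable_integrands.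

(** * Lebesgue measure: monotonicity, intervals, translations *)

Section lebesgue.
Context {R : realType}.
Notation mu := (@lebesgue_measure R).

(** Holds for arbitrary sets, [lebesgue_measure] being an outer measure; [attained_service] measures
    a set that is not known to be measurable. *)
Lemma le_lebesgue_measure : {homo mu : A B / A `<=` B >-> (A <= B)%E}.
Proof. by move=> A B AB; exact: le_outer_measure. Qed.

Lemma lebesgue_measure_itvbb (a b : R) (ba bb : bool) : a <= b ->
  mu [set` Interval (BSide ba a) (BSide bb b)] = (b - a)%:E.
Proof.
rewrite le_eqVlt => /predU1P[->|ab].
  by rewrite lebesgue_measure_itv/= lte_fin ltxx subrr.
by rewrite lebesgue_measure_itv/= lte_fin ab.
Qed.

(** Translation invariance, from the uniqueness of the measure with value [b - a] on []a, b]]. *)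
Lemma ge0_integral_shift (c : R) (f : R -> \bar R) :
  measurable_fun setT f -> (forall x, 0 <= f x)%E ->
  (\int[mu]_x f (c + x)%R = \int[mu]_x f x)%E.
Proof.
move=> mf f0.
pose s (x : measurableTypeR R) : measurableTypeR R := (c + x : R).
have ms : measurable_fun setT s by exact: measurable_funD.
have := @ge0_integral_pushforward _ _ _ _ R s ms (@lebesgue_measure R)
  setT f measurableT mf.
rewrite preimage_setT => <-; last by [].
apply: eq_measure_integral => A mA _; apply/esym.
apply: (@lebesgue_measure_unique R (pushforward (@lebesgue_measure R) s)) => //.
move=> _ [[a b] _ <-].
rewrite /= /pushforward (_ : _ @^-1` _ = `]a - c, b - c]%classic); last first.
  by apply/seteqP; split => x /=; rewrite /s !in_itv/= => /andP[? ?];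
    apply/andP; split; lra.
by rewrite !lebesgue_measure_itv/= !lte_fin ltrD2r -!EFinD opprB addrA subrK.
Qed.

End lebesgue.

Section tonelli.
Context d1 d2 (T1 : measurableType d1) (T2 : measurableType d2) (R : realType).
Variables (m1 : {sigma_finite_measure set T1 -> \bar R})
  (m2 : {sigma_finite_measure set T2 -> \bar R}).

Lemma tonelli (f : T1 -> T2 -> \bar R) :
  measurable_fun setT (fun z : T1 * T2 => f z.1 z.2) ->
  (forall x y, 0 <= f x y)%E ->
  (\int[m1]_x \int[m2]_y f x y = \int[m2]_y \int[m1]_x f x y)%E.
Proof.
move=> mf f0.
exact: (@fubini_tonelli _ _ _ _ _ m1 m2 _ mf (fun z => f0 z.1 z.2)).
Qed.

End tonelli.

(** * Random variables with an exponential law *)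

Section exponential_law.
Context {d : measure_display} {T : measurableType d} {R : realType}.
Variables (P : probability T R) (a : R) (X : T -> R).
Hypotheses (a_gt0 : 0 < a) (mX : measurable_fun setT X).
Hypothesis lawX : has_law P X (exponential_prob a).
Notation mu := (@lebesgue_measure R).

Lemma exponential_law_lt0 : P [set w | X w < 0] = 0%E.
Proof.
have := lawX _ (measurable_itv `]-oo, 0[).
rewrite (_ : X @^-1` _ = [set w | X w < 0]); last first.
  by apply/seteqP; split => w /=; rewrite in_itv.
move=> ->; apply: integral0_eq => x /=; rewrite in_itv/= => x0.
by rewrite lt0_exponential_pdf.
Qed.

Lemma exponential_law_le (v : R) : 0 <= v ->
  P [set w | X w <= v] = (1 - expR (- a * v))%:E.
Proof.
move=> v0.
have -> : [set w | X w <= v] =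
    X @^-1` `]-oo, 0[%classic `|` X @^-1` `[0, v]%classic.
  apply/seteqP; split => w /=; rewrite !in_itv/=.
    by case: (ltP (X w) 0) => [?|/= _ ->]; [left|right].
  by case=> [/ltW/le_trans|/andP[]//]; apply.
rewrite measureU; last 3 first.
- by rewrite -[X @^-1` _]setTI; exact: mX.
- by rewrite -[X @^-1` _]setTI; exact: mX.
- rewrite -subset0 => w/=; rewrite !in_itv/= => -[+ /andP[+ _]].
  by move=> /lt_le_trans/[apply]; rewrite ltxx.
rewrite [X in (X + _)%E](_ : _ = 0%E) ?add0e; last first.
  by rewrite -exponential_law_lt0; congr (P _); apply/seteqP; split => w /=;
    rewrite in_itv.
transitivity (exponential_prob a `[0, v]); first exact: lawX.
case: (ltP 0 v) => [v1|v1]; first exact: exponential_prob_itv0c.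
have -> : v = 0 by apply/eqP; rewrite eq_le v1.
by rewrite mulr0 expR0 subrr set_itv1/= /exponential_prob integral_set1.
Qed.

Lemma exponential_law_gt (v : R) : 0 <= v ->
  P [set w | v < X w] = (expR (- a * v))%:E.
Proof.
move=> v0; have mA : measurable [set w | X w <= v].
  by rewrite -[X in measurable X]setTI; exact: measurable_fun_le.
rewrite (_ : [set w | v < X w] = ~` [set w | X w <= v]); last first.
  by apply/seteqP; split => w /=; rewrite real_ltNge ?num_real// => /negP.
by rewrite probability_setC// exponential_law_le// -EFinB opprB addrCA subrr addr0.
Qed.

(** Layer cake: each value [c] is the length of [[0, c[], and exchanging the integrals reduces the
    claim to probabilities of measurable sets, which are what [has_law] provides. *)
Lemma ge0_integral_exponential_law (g : R -> R) :
  measurable_fun setT g -> (forall x, 0 <= g x) ->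
  (\int[P]_w (g (X w))%:E = \int[mu]_v (g v * exponential_pdf a v)%:E)%E.
Proof.
move=> mg g0.
have pdf0 x : 0 <= exponential_pdf a x by rewrite exponential_pdf_ge0// ltW.
have cake (c : R) : 0 <= c -> (\int[mu]_s (\1_(`[0, c[%classic) s)%:E = c%:E)%E.
  move=> c0; rewrite integral_indic// setIT.
  by apply: (etrans (lebesgue_measure_itvbb 0 c true true c0)); rewrite subr0.
have mI d' (U : measurableType d') (f : U -> R) : measurable_fun setT f ->
    measurable_fun setT
      (fun z : U * R => (\1_(`[0, f z.1[%classic) z.2 : R)%:E).
  move=> mf; apply/measurable_EFinP.
  rewrite [X in measurable_fun _ X](_ : _ =
      fun z : U * R => if (0 <= z.2) && (z.2 < f z.1) then 1 else 0); last first.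
    by apply/funext => z; rewrite indicE mem_setE in_itv/=; case: ifP.
  apply: measurable_fun_ifT => //; apply: measurable_and.
    by apply: measurable_fun_ler => //; exact: measurable_snd.
  apply: measurable_fun_ltr; first exact: measurable_snd.
  by apply: measurableT_comp => //; exact: measurable_fst.
under eq_integral => w _ do rewrite -(cake (g (X w)))//.
rewrite (@tonelli _ _ _ _ _ P mu
  (fun w s => (\1_(`[0, g (X w)[%classic) s : R)%:E))//; last first.
  by apply: (mI _ _ (g \o X)); exact: measurableT_comp.
under [RHS]eq_integral => v _.
  rewrite mulrC EFinM -(cake (g v))// -ge0_integralZl//=; last 2 first.
  - exact/measurable_EFinP/measurable_indic.
  - by rewrite lee_fin.
  over.
rewrite (@tonelli _ _ _ _ _ mu mu (fun v s => (exponential_pdf a v)%:E *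
   (\1_(`[0, g v[%classic) s : R)%:E)%E)//; last 2 first.
- apply: emeasurable_funM; last exact: mI.
  apply/measurable_EFinP/measurableT_comp; last exact: measurable_fst.
  exact: measurable_exponential_pdf.
- by move=> v s; rewrite mule_ge0// lee_fin.
apply: eq_integral => s _ /=.
pose A := [set v | 0 <= s < g v].
have mA : measurable A.
  have mb : measurable_fun setT (fun v => (0 <= s) && (s < g v)).
    by apply: measurable_and => //; exact: measurable_fun_ltr.
  by rewrite -[A]setTI; exact: (mb measurableT [set true]).
have E x : \1_(`[0, g x[%classic) s = \1_A x :> R.
  by rewrite !indicE; congr (_ _)%:R; apply/idP/idP; rewrite !inE/= in_itv.
under eq_integral do rewrite E.
rewrite (_ : (fun w => _) = fun w => (\1_(X @^-1` A) w)%:E)//.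
have mXA : measurable (X @^-1` A) by rewrite -[X @^-1` A]setTI; exact: mX.
rewrite integral_indic// setIT.
transitivity (exponential_prob a A); first exact: lawX.
rewrite /exponential_prob integral_mkcond.
apply: eq_integral => v _ /=; rewrite E patchE indicE.
by case: ifP; rewrite ?mule1 ?mule0.
Qed.

(* The exponential density [a * expR (- a * v)] is [a] times the probability
   of surviving [v]: observing at rate [a] up to [X] is observing once, at [X]. *)
Lemma exponential_law_pasta (g : R -> R) :
  measurable_fun setT g -> (forall x, 0 <= g x) ->
  (\int[P]_w \int[mu]_v (if (0 <= v < X w)%R then g v else 0)%:E =
   (a^-1)%:E * \int[P]_w (g (X w))%:E)%E.
Proof.
move=> mg g0.
rewrite ge0_integral_exponential_law//.
rewrite (@tonelli _ _ _ _ _ P mu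
   (fun w v => (if (0 <= v < X w)%R then g v else 0)%:E)); last 2 first.
- apply/measurable_EFinP; apply: measurable_fun_ifT => //.
  + apply: measurable_and.
      by apply: measurable_fun_ler => //; exact: measurable_snd.
    apply: measurable_fun_ltr; first exact: measurable_snd.
    by apply: measurableT_comp => //; exact: measurable_fst.
  + by apply: measurableT_comp => //; exact: measurable_snd.
- by move=> w v; rewrite lee_fin; case: ifP.
rewrite -ge0_integralZl//=; last 3 first.
- apply/measurable_EFinP/measurable_funM => //.
  exact: measurable_exponential_pdf.
- by move=> v _; rewrite lee_fin mulr_ge0// exponential_pdf_ge0// ltW.
- by rewrite lee_fin invr_ge0 ltW.
apply: eq_integral => v _.
have [v0|v0] := leP 0 v; last first.
  by rewrite integral0 lt0_exponential_pdf// mulr0 mule0.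
pose A := [set w | v < X w].
have mA : measurable A.
  have mb : measurable_fun setT (fun w => v < X w).
    exact: measurable_fun_ltr.
  by rewrite -[A]setTI; exact: (mb measurableT [set true]).
transitivity ((g v)%:E * P A)%E; last first.
  rewrite exponential_pdfE// exponential_law_gt// -!EFinM; congr EFin.
  by field; rewrite gt_eqF.
rewrite -[A]setIT -integral_indic// -ge0_integralZl//=; last 2 first.
- exact/measurable_EFinP/measurable_indic.
- by rewrite lee_fin.
apply: eq_integral => w _; rewrite indicE.
rewrite (_ : (w \in A) = (v < X w)); last by apply/idP/idP; rewrite inE.
by case: (_ < _); rewrite ?mule1 ?mule0.
Qed.

End exponential_law.

(** Follows the structure of the eta-expanded function. The last rule composes with the
    measurability facts found in the context, which is why proofs introduce them as hypotheses
    beforehand. *)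
Ltac measurability := cbn beta;
  repeat (first
  [ assumption | exact: measurable_cst | exact: measurable_id
  | exact: measurable_fst | exact: measurable_snd
  | match goal with
    | |- @measurable_fun ?d1 ?d2 ?T1 ?T2 ?D ?f =>
        lazymatch f with
        | fun z => _ => fail
        | _ => change (@measurable_fun d1 d2 T1 T2 D (fun z => f z))
        end
    | |- measurable_fun _ (fun z => EFin _) => apply/measurable_EFinP
    | |- measurable_fun _ (fun z => if _ then _ else _) => apply: measurable_fun_ifT
    | |- measurable_fun _ (fun z => andb _ _) => apply: measurable_and
    | |- measurable_fun _ (fun z => (_ <= _)%R) => apply: measurable_fun_ler
    | |- measurable_fun _ (fun z => (_ < _)%R) => apply: measurable_fun_ltr
    | |- measurable_fun _ (fun z => (_, _)) => apply: measurable_fun_pair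
    | |- measurable_fun _ (fun z => (_ + - _)%R) => apply: measurable_funB
    | |- measurable_fun _ (fun z => (_ + _)%R) => apply: measurable_funD
    | |- measurable_fun _ (fun z => (_ * _)%R) => apply: measurable_funM
    | |- measurable_fun _ (fun z => Num.norm (@?g z)) =>
        apply: (measurableT_comp (@normr_measurable _ setT) (g := g))
    | |- measurable_fun _ (fun z => expR (@?g z)) =>
        apply: (measurableT_comp (@measurable_expR _) (g := g))
    | |- measurable_fun _ (fun z => fst (@?g z)) =>
        apply: (measurableT_comp measurable_fst (g := g))
    | |- measurable_fun _ (fun z => snd (@?g z)) =>
        apply: (measurableT_comp measurable_snd (g := g))
    | H : measurable_fun _ ?f |- measurable_fun _ (fun z => ?f (@?g z)) =>
        apply: (measurableT_comp H (g := g))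
    end ]; cbn beta).

(** * Integrals against the exponential density *)

Section exponential_mean.
Context {R : realType}.
Variables (a : R) (a_gt0 : 0 < a).
Notation mu := (@lebesgue_measure R).

Definition exponential_mean (a : R) (f : R -> R) : \bar R :=
  (\int[mu]_v (f v * exponential_pdf a v)%:E)%E.

Let pdf_ge0 x : 0 <= exponential_pdf a x.
Proof. by rewrite exponential_pdf_ge0// ltW. Qed.

Let measurable_pdf : measurable_fun setT (exponential_pdf a).
Proof. exact: measurable_exponential_pdf. Qed.

Lemma exponential_mean_ge0 (f : R -> R) : (forall x, 0 <= f x) ->
  (0 <= exponential_mean a f)%E.
Proof. by move=> f0; apply: integral_ge0 => v _; rewrite lee_fin mulr_ge0. Qed.

Lemma exponential_mean1 : exponential_mean a (cst 1) = 1%E.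
Proof.
rewrite -(integral_exponential_pdf a_gt0).
by apply: eq_integral => v _; rewrite mul1r.
Qed.

Lemma exponential_meanD (f g : R -> R) :
  measurable_fun setT f -> (forall x, 0 <= f x) ->
  measurable_fun setT g -> (forall x, 0 <= g x) ->
  (exponential_mean a (fun x => f x + g x)%R =
   exponential_mean a f + exponential_mean a g)%E.
Proof.
move=> mf f0 mg g0; rewrite -ge0_integralD//.
- by apply: eq_integral => v _; rewrite -EFinD mulrDl.
- by move=> v _; rewrite lee_fin mulr_ge0.
- by measurability.
- by move=> v _; rewrite lee_fin mulr_ge0.
- by measurability.
Qed.

Lemma exponential_meanZ (c : R) (f : R -> R) : 0 <= c ->
  measurable_fun setT f -> (forall x, 0 <= f x) ->
  (exponential_mean a (fun x => c * f x)%R = c%:E * exponential_mean a f)%E.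
Proof.
move=> c0 mf f0; rewrite -ge0_integralZl//.
- by apply: eq_integral => v _; rewrite -EFinM mulrA.
- by measurability.
- by move=> v _; rewrite lee_fin mulr_ge0.
Qed.

(** The probability that a packet of service time [s] is preempted; the test is oriented as in
    [peak_age]. *)
Lemma exponential_mean_lt (s : R) : 0 <= s ->
  exponential_mean a (fun v => if s <= v then 0 else 1) = (1 - expR (- a * s))%:E.
Proof.
rewrite le_eqVlt => /predU1P[<-|s0].
  rewrite mulr0 expR0 subrr; apply: integral0_eq => v _.
  have [v0|v0] := leP 0 v; first by rewrite mul0r.
  by rewrite lt0_exponential_pdf// mulr0.
transitivity (\int[mu]_(v in `[0%R, s[) (exponential_pdf a v)%:E)%E.
  rewrite [RHS]integral_mkcond; apply: eq_integral => v _.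
  rewrite patchE mem_setE in_itv/= ltNge.
  have [v0|v0] := leP 0 v; first by case: ifP; rewrite ?mul0r ?mul1r.
  by rewrite lt0_exponential_pdf// mulr0.
rewrite integral_itv_bndo_bndc; last by measurability.
exact: exponential_prob_itv0c.
Qed.

Lemma exponential_mean_ge (s : R) : 0 <= s ->
  exponential_mean a (fun v => if s <= v then 1 else 0) = (expR (- a * s))%:E.
Proof.
move=> s0.
have h : (exponential_mean a (fun v => if s <= v then 0 else 1)%R +
    exponential_mean a (fun v => if s <= v then 1 else 0)%R = 1)%E.
  rewrite -exponential_mean1 -exponential_meanD.
  - by apply: eq_integral => v _; case: ifP => _; rewrite ?addr0 ?add0r.
  - by measurability.
  - by move=> x; case: ifP.
  - by measurability.
  - by move=> x; case: ifP.
move: h; rewrite exponential_mean_lt//.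
case: (exponential_mean a _) => [r| |]// [h].
by congr EFin; lra.
Qed.

(* Tonelli on [{(s, v) | 0 <= s <= v}], the tail being [expR (- a * s)]. *)
Lemma exponential_mean_norm : exponential_mean a (fun v => `|v|) = a^-1%:E.
Proof.
pose c (v s : R) := if (0 <= s) && (s <= v) then exponential_pdf a v else 0.
have mc : measurable_fun setT (fun z : R * R => c z.1 z.2).
  by rewrite /c; measurability.
have c0 v s : 0 <= c v s by rewrite /c; case: ifP.
transitivity (\int[mu]_v \int[mu]_s (c v s)%:E)%E.
  apply: eq_integral => v _.
  have [v0|v0] := leP 0 v; last first.
    rewrite lt0_exponential_pdf// mulr0; apply/esym/integral0_eq => s _.
    by rewrite /c lt0_exponential_pdf//; case: ifP.
  transitivity (\int[mu]_(s in `[0%R, v]) (exponential_pdf a v)%:E)%E.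
    rewrite integral_cst//= (lebesgue_measure_itvbb 0 v true false v0) subr0.
    by rewrite ger0_norm// mulrC.
  rewrite integral_mkcond; apply: eq_integral => s _.
  by rewrite patchE mem_setE in_itv/= /c; case: ifP.
rewrite (@tonelli _ _ _ _ _ mu mu (fun v s => (c v s)%:E))//; last first.
  exact/measurable_EFinP.
transitivity (\int[mu]_s (a^-1%:E * (exponential_pdf a s)%:E))%E; last first.
  rewrite ge0_integralZl//; first by rewrite integral_exponential_pdf// mule1.
  - by measurability.
  - by move=> s _; rewrite lee_fin.
  - by rewrite lee_fin invr_ge0 ltW.
apply: eq_integral => s _; have [s0|s0] := leP 0 s; last first.
  rewrite lt0_exponential_pdf// mule0; apply: integral0_eq => v _.
  by rewrite /c leNgt s0.
rewrite -EFinM exponential_pdfE// mulrA mulVf ?mul1r ?gt_eqF//.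
rewrite -exponential_mean_ge//; apply: eq_integral => v _.
by rewrite /c s0/=; case: ifP; rewrite ?mul1r ?mul0r.
Qed.

(** Exponential tilting: discounting at rate [eps] raises the rate to [a + eps], at the cost of the
    Laplace transform of the law at [eps]. It reduces every coefficient of the discounted recursion
    to an undiscounted one. *)
Lemma exponential_mean_tilt (eps : R) (f : R -> R) : 0 <= eps ->
  measurable_fun setT f -> (forall x, 0 <= f x) ->
  (exponential_mean a (fun v => expR (- eps * v) * f v)%R =
   (a / (a + eps))%:E *
   \int[mu]_v (f v * exponential_pdf (a + eps) v)%:E)%E.
Proof.
move=> eps0 mf f0; rewrite -ge0_integralZl//.
- apply: eq_integral => v _; rewrite -EFinM; congr EFin.
  have [v0|v0] := leP 0 v; last by rewrite !lt0_exponential_pdf// !mulr0.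
  rewrite !exponential_pdfE//.
  have -> : - (a + eps) * v = - eps * v + - a * v by ring.
  by rewrite expRD; field; rewrite gt_eqF// ltr_pwDl.
- have := measurable_exponential_pdf (a + eps).
  by move=> mpdf; measurability.
- by move=> v _; rewrite lee_fin mulr_ge0// exponential_pdf_ge0// addr_ge0// ltW.
- by rewrite lee_fin divr_ge0 ?addr_ge0// ltW.
Qed.

End exponential_mean.

(** * Independence of two random elements *)

Section independence.
Context {d d1 d2 : measure_display} {T : measurableType d}.
Context {E1 : measurableType d1} {E2 : measurableType d2} {R : realType}.
Variable P : probability T R.

(** The scalar [c] will be the probability of an event to which the measures are restricted; scaling
    by it avoids conditioning, hence dividing by a possibly zero probability. *)
Lemma eq_measure_rectangles (p1 : probability E1 R) (p2 : probability E2 R)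
    (c : {nonneg R}) (m m' : {measure set (E1 * E2) -> \bar R}) :
  (forall A B, measurable A -> measurable B ->
     m (A `*` B) = p1 A * (c%:num%:E * p2 B))%E ->
  (forall A B, measurable A -> measurable B ->
     m' (A `*` B) = p1 A * (c%:num%:E * p2 B))%E ->
  forall A, measurable A -> m A = m' A.
Proof.
move=> mE m'E A mA.
by rewrite -(@product_measure_unique _ _ _ _ _ p1 (mscale c p2) m mE)//
           -(@product_measure_unique _ _ _ _ _ p1 (mscale c p2) m' m'E).
Qed.

Variables (Y : T -> E1) (Z : T -> E2).
Hypotheses (mY : measurable_fun setT Y) (mZ : measurable_fun setT Z).

Let Y' : {mfun T >-> E1} := HB.pack Y (isMeasurableFun.Build _ _ _ _ Y mY).
Let Z' : {mfun T >-> E2} := HB.pack Z (isMeasurableFun.Build _ _ _ _ Z mZ).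
Let YZ w := (Y w, Z w).
Let mYZ : measurable_fun setT YZ. Proof. exact: measurable_fun_pair. Qed.
Let YZ' : {mfun T >-> (E1 * E2)%type} :=
  HB.pack YZ (isMeasurableFun.Build _ _ _ _ YZ mYZ).

Definition independent2 := forall A B, measurable A -> measurable B ->
  P (Y @^-1` A `&` Z @^-1` B) = (P (Y @^-1` A) * P (Z @^-1` B))%E.

Hypothesis indYZ : independent2.

(** The joint law is the product of the marginals, since it is so on rectangles; Tonelli then
    integrates over [Z] with [Y] frozen. *)
Lemma ge0_integral_independent2 (f : E1 -> E2 -> \bar R) :
  measurable_fun setT (fun z : E1 * E2 => f z.1 z.2) ->
  (forall x y, 0 <= f x y)%E ->
  (\int[P]_w f (Y w) (Z w) = \int[P]_w \int[P]_w' f (Y w) (Z w'))%E.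
Proof.
move=> mf f0.
have := @ge0_integral_pushforward _ _ _ _ R YZ mYZ P setT _ measurableT mf.
rewrite preimage_setT => <-; last by [].
transitivity (\int[distribution P Y' \x distribution P Z']_z f z.1 z.2)%E.
  apply: eq_measure_integral => A mA _; apply/esym.
  apply: (@product_measure_unique _ _ _ _ _ (distribution P Y')
    (distribution P Z') (distribution P YZ')) => //.
rewrite fubini_tonelli1//.
have := @ge0_integral_pushforward _ _ _ _ R Y mY P setT
  (fubini_F (distribution P Z') (fun z => f z.1 z.2)) measurableT.
rewrite preimage_setT => ->; last 2 first.
- exact: measurable_fun_fubini_tonelli_F.
- by move=> x _; exact: integral_ge0.
apply: eq_integral => w _ /=; rewrite /fubini_F/=.
have := @ge0_integral_pushforward _ _ _ _ R Z mZ P setT (f (Y w)) measurableT.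
rewrite preimage_setT => ->//.
exact: measurableT_comp mf (measurable_pair1 _).
Qed.

(** Both sides are finite measures in [A] that agree on rectangles. *)
Lemma independent2_restr (F : set T) : measurable F ->
  (forall A B, measurable A -> measurable B ->
    P (Y @^-1` A `&` Z @^-1` B `&` F) =
    (P (Y @^-1` A) * P (Z @^-1` B) * P F)%E) ->
  forall A, measurable A -> P (YZ @^-1` A `&` F) = (P (YZ @^-1` A) * P F)%E.
Proof.
move=> mF indF A mA.
have PF0 : 0 <= fine (P F) by rewrite fine_ge0.
have PFE : (fine (P F))%:E = P F by rewrite fineK// fin_num_measure.
rewrite muleC -PFE.
pose m1 := pushforward (mrestr P mF) YZ'.
pose m2 := mscale (NngNum PF0) (distribution P YZ').
apply: (@eq_measure_rectangles (distribution P Y') (distribution P Z')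
  (NngNum PF0) m1 m2) => // B C mB mC /=.
- apply: etrans (indF _ _ mB mC) _.
  by rewrite -muleA /= PFE; congr (_ * _)%E; exact: muleC.
- apply: etrans (congr1 (mule _) (indYZ _ _ mB mC)) _.
  exact: muleCA.
Qed.

End independence.

(** * Independence of a state from a family of clocks *)

Section independent_family.
Context {d : measure_display} {T : measurableType d} {R : realType}.
Context (P : probability T R) {I : eqType} (X : I -> T -> R).
Hypotheses (mX : forall i, measurable_fun setT (X i))
           (indX : mutually_independent P X).

Let cylinder (s : seq I) (B : I -> set R) :=
  [set w | forall i, i \in s -> B i (X i w)].

Let cylinder_cons i s B :
  cylinder (i :: s) B = X i @^-1` B i `&` cylinder s B.
Proof.
apply/seteqP; split => w /=.
  by move=> h; split=> [|j js]; apply: h; rewrite inE ?eqxx// js orbT.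
by move=> [Bi Bs] j; rewrite inE => /predU1P[->//|]; exact: Bs.
Qed.

Let measurable_cylinder s B : (forall i, measurable (B i)) ->
  measurable (cylinder s B).
Proof.
move=> mB; elim: s => [|i s IHs].
  by rewrite (_ : cylinder _ _ = setT)//; apply/seteqP; split.
rewrite cylinder_cons; apply: measurableI => //.
by rewrite -[X in measurable X]setTI; exact: mX.
Qed.

(** [K] holds the clocks that the state [Y] has not yet read; each step of the recursion removes
    from [K] those that it reads. *)
Definition independent_of_family {d'} {E : measurableType d'}
    (Y : T -> E) (K : pred I) :=
  forall (A : set E) (s : seq I) (B : I -> set R), measurable A -> uniq s ->
    {in s, forall i, K i} -> (forall i, measurable (B i)) ->
    P (Y @^-1` A `&` [set w | forall i, i \in s -> B i (X i w)]) =
    (P (Y @^-1` A) * \prod_(i <- s) P (X i @^-1` B i))%E.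

Context {d' : measure_display} {E : measurableType d'}.
Variables (Y : T -> E) (K : pred I).
Hypotheses (mY : measurable_fun setT Y) (indY : independent_of_family Y K).

Lemma independent_of_family2 i : K i -> independent2 P Y (X i).
Proof.
move=> Ki A B mA mB; have := indY A [:: i] (fun=> B) mA isT.
rewrite big_seq1 => <- //; last by move=> j; rewrite inE => /eqP ->.
by congr (P (_ `&` _)); apply/seteqP; split => w /= h => [j|];
  [rewrite inE => /eqP -> | apply: h; rewrite inE].
Qed.

Lemma independent_of_family_sub (K' : pred I) : {subset K' <= K} ->
  independent_of_family Y K'.
Proof. by move=> K'K A s B mA us Ks mB; apply: indY => // i /Ks /K'K. Qed.

Lemma independent_of_family_comp {d2} {E2 : measurableType d2} (f : E -> E2) :
  measurable_fun setT f -> independent_of_family (f \o Y) K.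
Proof.
move=> mf A s B mA us Ks mB; apply: (indY (f @^-1` A)) => //.
by rewrite -[X in measurable X]setTI; exact: mf.
Qed.

Lemma independent_of_family_pair i : K i ->
  independent_of_family (fun w => (Y w, X i w)) [pred j | K j & j != i].
Proof.
move=> Ki A s B mA us Ks mB.
have iNs : i \notin s by apply/negP => /Ks /=; rewrite eqxx andbF.
have PF : P (cylinder s B) = (\prod_(j <- s) P (X j @^-1` B j))%E by exact: indX.
rewrite -PF; apply: independent2_restr => //.
- exact: independent_of_family2.
- exact: measurable_cylinder.
move=> A' B' mA' mB'.
(* Placing [B'] at index [i] turns the rectangle into an instance of the hypothesis for [i :: s]. *)
pose C j := if j == i then B' else B j.
have CE j : j \in s -> C j = B j.
  by rewrite /C; case: eqP => // -> is_; rewrite is_ in iNs.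
have mC j : measurable (C j) by rewrite /C; case: ifP.
have := indY A' (i :: s) C mA'; rewrite /= iNs us => /(_ isT) h.
rewrite PF -setIA -muleA.
have -> : X i @^-1` B' `&` cylinder s B = cylinder (i :: s) C.
  rewrite cylinder_cons {1}/C eqxx.
  congr (_ `&` _); apply/seteqP; split => w /= H j js;
    by have := H j js; rewrite CE.
rewrite h//; last first.
  by move=> j; rewrite inE => /predU1P[->//|/Ks /andP[]].
rewrite big_cons {1}/C eqxx; congr (_ * (_ * _))%E.
by rewrite !big_seq; apply: eq_bigr => j js; rewrite CE.
Qed.

End independent_family.

(** * The age along one sample path *)

Section sample_path_age.
Context {R : realType}.
Variables (gen service : nat -> R) (sigma : R -> option nat).
Hypotheses (gen0_gt0 : 0 < gen 0%N) (gen_incr : forall k, gen k < gen k.+1)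
  (service_ge0 : forall k, 0 <= service k) (sigma_lcfsp : lcfsp gen service sigma).

(* The age just before packet [k] is generated. *)
Fixpoint peak_age (gen service : nat -> R) (k : nat) : R :=
  if k is j.+1 then
    gen j.+1 - gen j +
    (if service j <= gen j.+1 - gen j then 0 else peak_age gen service j)
  else gen 0%N.

Let Z := peak_age gen service.

Let gen_lt i j : (i < j)%N -> gen i < gen j.
Proof. by elim: j i => // j IHj i; rewrite ltnS leq_eqVlt => /predU1P[->//|/IHj/lt_trans->]. Qed.

Let gen_le i j : (i <= j)%N -> gen i <= gen j.
Proof. by rewrite leq_eqVlt => /predU1P[->//|/gen_lt/ltW]. Qed.

Let gen_gt0 i : 0 < gen i.
Proof. exact: lt_le_trans gen0_gt0 (gen_le _ _ (leq0n i)). Qed.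

Let gen_le_index u i k : gen i <= u -> u < gen k.+1 -> (i <= k)%N.
Proof.
move=> iu uk; rewrite leqNgt; apply/negP => /gen_le ki.
by have := le_lt_trans (le_trans ki iu) uk; rewrite ltxx.
Qed.

(** Packet [i] is served in one piece, without preemption, and is delivered by time [u]. *)
Let success i u := service i <= gen i.+1 - gen i /\ gen i + service i <= u.

Let attained_nd i u v : u <= v ->
  (attained_service sigma i u <= attained_service sigma i v)%E.
Proof.
move=> uv; apply: le_lebesgue_measure => s /= [/andP[s0 su] ?].
by split=> //; rewrite s0 (le_trans su).
Qed.

Let attained_le i u a b : a <= b ->
  (forall s, 0 <= s <= u -> sigma s = Some i -> a <= s <= b) ->
  (attained_service sigma i u <= (b - a)%:E)%E.
Proof.
move=> ab h; rewrite -(lebesgue_measure_itvbb a b true false ab).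
by apply: le_lebesgue_measure => s /= [? ?]; rewrite in_itv/= h.
Qed.

Let served_generated i s : 0 <= s -> sigma s = Some i -> gen i <= s.
Proof. by move=> s0 /(sigma_lcfsp s i s0)[[]]. Qed.

(** Packet [k] has had at most [u - gen k] of service, so it is still present, and no later packet
    competes with it. *)
Let latest_served k u : gen k <= u -> u < gen k.+1 -> u < gen k + service k ->
  sigma u = Some k.
Proof.
move=> ku uk us; apply/sigma_lcfsp; first exact: le_trans (ltW (gen_gt0 k)) ku.
split; last by move=> j [ju _]; exact: gen_le_index ju uk.
split=> //; apply: (@le_lt_trans _ _ (u - gen k)%:E); last by rewrite lte_fin; lra.
apply: attained_le => // s /andP[s0 su] sk.
by rewrite su (served_generated _ _ s0 sk).
Qed.

(** The server stays on packet [i] throughout [[gen i, gen i + service i[]. *)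
Let success_received i u : success i u -> received gen service sigma u i.
Proof.
move=> [siX sui]; have si0 := service_ge0 i; split; first by rewrite /=; lra.
have sE : service i = (gen i + service i) - gen i by lra.
rewrite {1}sE -(lebesgue_measure_itvbb (gen i) (gen i + service i) true true);
  last by lra.
apply: le_lebesgue_measure => s /=; rewrite in_itv/= => /andP[is_ si].
have s0 := le_trans (ltW (gen_gt0 i)) is_.
by split; [apply/andP; split=> //; lra | apply: latest_served => //; lra].
Qed.

(** Downward induction from the latest packet [k]. If packet [i.+1] is still incomplete at [u], its
    presence has blocked packet [i] ever since [gen i.+1]; packet [i] was thus served only during
    its own interarrival interval, which was too short. *)
Let not_success_in_system k u : gen k <= u -> u < gen k.+1 ->
  forall i, (i <= k)%N -> (forall j, (i <= j <= k)%N -> ~ success j u) ->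
  (attained_service sigma i u < (service i)%:E)%E.
Proof.
move=> ku uk i ik; rewrite -(subKn ik).
have := leq_subr i k; move: (k - i)%N => n; elim: n => [_ | n IHn nk] ns.
  rewrite subn0 in ns *; have nsk := ns k; rewrite leqnn in nsk.
  apply: (@le_lt_trans _ _ (u - gen k)%:E).
    apply: attained_le => // s /andP[s0 su] sk.
    by rewrite su (served_generated _ _ s0 sk).
  by rewrite lte_fin ltNge; apply/negP => h; apply: nsk => //; split; lra.
have jE : (k - n = (k - n.+1).+1)%N by rewrite subnS prednK// subn_gt0.
set i' := (k - n.+1)%N in ns jE *.
have i'k : (i' <= k)%N by exact: leq_subr.
have {}IHn : (attained_service sigma i'.+1 u < (service i'.+1)%:E)%E.
  rewrite -jE; apply: IHn; first exact: ltnW.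
  by move=> j /andP[nj jk]; apply: ns; rewrite jk andbT (leq_trans _ nj)// jE.
have i'u : gen i'.+1 <= u by rewrite (le_trans _ ku)// gen_le// -jE leq_subr.
apply: (@le_lt_trans _ _ (gen i'.+1 - gen i')%:E); last first.
  rewrite lte_fin ltNge; apply/negP => h.
  by have := ns i'; rewrite leqnn i'k; apply => //; split=> //; lra.
apply: attained_le; first exact: ltW.
move=> s /andP[s0 su] si'; rewrite (served_generated _ _ s0 si')/= leNgt.
apply/negP => ls.
have [_ /(_ i'.+1)] := (sigma_lcfsp s i' s0).1 si'.
rewrite ltnn; suff /[swap]/[apply] : in_system gen service sigma s i'.+1 by [].
by split; [exact: ltW | exact: le_lt_trans (attained_nd _ _ _ su) IHn].
Qed.

(** The late delivery of a preempted packet is always accompanied by a success at least as fresh, so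
    it never determines the age. *)
Let received_success k u j : gen k <= u -> u < gen k.+1 ->
  received gen service sigma u j ->
  exists2 i, (j <= i <= k)%N & success i u.
Proof.
move=> ku uk [ju ]; rewrite leNgt => /negP aj.
apply: contrapT => /forall2NP h; apply: aj.
apply: (not_success_in_system _ _ ku uk); first exact: gen_le_index ju uk.
by move=> i ji; have [] := h i.
Qed.

(** The recursion unrolled: [Z k] is the minimum of [gen k], due to the update held at time 0, and
    of [gen k - gen i] over the unpreempted packets [i < k]. *)
Let freshest k : [/\ Z k <= gen k,
    Z k = gen k \/
      exists i, [/\ (i < k)%N, service i <= gen i.+1 - gen i &
                    Z k = gen k - gen i] &
    forall i, (i < k)%N -> service i <= gen i.+1 - gen i -> Z k <= gen k - gen i].
Proof.
rewrite /Z; elim: k => [|k [le ex all]]; first by split=> //; left.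
rewrite /=; case: ifPn => sk; rewrite ?addr0.
  split; first by have := gen_gt0 k; lra.
    by right; exists k; split.
  by move=> i; rewrite ltnS => /gen_le ik _; lra.
split; first lra.
  case: ex => [->|[i [ik si ->]]]; first by left; lra.
  by right; exists i; split=> //; [exact: ltnW | lra].
move=> i; rewrite ltnS leq_eqVlt => /predU1P[->|ik si]; first by rewrite (negbTE sk).
by have := all _ ik si; lra.
Qed.

Lemma peak_age_ge0 k : 0 <= peak_age gen service k.
Proof.
elim: k => [|k IHk] /=; first exact: ltW.
by case: ifP => _; have := gen_incr k; lra.
Qed.

Lemma age_before_first u : 0 <= u -> u < gen 0%N ->
  age gen service sigma u = u%:E.
Proof.
move=> u0 ug; rewrite /age; apply: min_l; apply: le_ereal_inf_tmp.
move=> _ [i [iu _] <-]; have := gen_le _ _ (leq0n i); rewrite /= in iu *.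
by rewrite lee_fin; lra.
Qed.

(** Unpreempted packets before [k] have all been delivered by [gen k], so during this interval the
    age can drop only through the success of packet [k] itself. *)
Lemma age_between k u : gen k <= u -> u < gen k.+1 ->
  age gen service sigma u =
  (u - gen k + (if service k <= u - gen k then 0 else peak_age gen service k))%:E.
Proof.
move=> ku uk; have gk0 := gen_gt0 k; have [Zle Zex Zall] := freshest k.
have inf_le i : success i u ->
    (age gen service sigma u <= (u - gen i)%:E)%E.
  move=> /success_received ri; rewrite /age ge_min; apply/orP; right.
  by apply: ereal_inf_lbound; exists i.
have le_age (c : R) : c <= u ->
    (forall i, (i <= k)%N -> success i u -> c <= u - gen i) ->
    (c%:E <= age gen service sigma u)%E.
  move=> cu h; rewrite /age le_min lee_fin cu/=; apply: le_ereal_inf_tmp.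
  move=> _ [j rj <-]; have [i /andP[ji ik] si] := received_success _ _ _ ku uk rj.
  by have := h _ ik si; have := gen_le _ _ ji; rewrite lee_fin; lra.
apply/eqP; rewrite eq_le; case: ifPn => sk; apply/andP; split.
- by rewrite addr0; apply: inf_le; split; lra.
- apply: le_age; first lra.
  by move=> i /gen_le ik _; lra.
- case: Zex => [Zk|[i [ik si Zk]]]; rewrite -/Z Zk.
    by rewrite /age ge_min lee_fin; apply/orP; left; lra.
  rewrite (_ : _ + _ = u - gen i); last lra.
  by apply: inf_le; split=> //; have := gen_le _ _ ik; lra.
- apply: le_age; first by rewrite -/Z; lra.
  move=> i; rewrite leq_eqVlt => /predU1P[->[_ h]|ik [si _]].
    by exfalso; move/negP: sk; apply; lra.
  by have := Zall _ ik si; rewrite -/Z; lra.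
Qed.

End sample_path_age.

(** * Cycles between generations as a recursion on states *)

Section renewal_cycles.
Context {R : realType}.

(** The components of [y] are the time of a generation, the age just before it and the service time
    of the new packet; [x] is the wait until the next generation. *)
Definition next_peak (y : (R * R) * R) (x : R) : R * R :=
  (y.1.1 + x, x + (if y.2 <= x then 0 else y.1.2)).

(* Cycle [n.+1] starts when packet [n] is generated: the state records that
   time, the age just before it, and the service time of packet [n].  Cycle [0]
   starts at time [0]. *)
Fixpoint cycle_start (x s : nat -> R) (n : nat) : (R * R) * R :=
  if n is k.+1 then (next_peak (cycle_start x s k) (x k), s k) else (0, 0, 0).

Lemma cycle_start_peak_age (gen s x : nat -> R) (n : nat) :
  x 0%N = gen 0%N -> (forall k, x k.+1 = gen k.+1 - gen k) ->
  cycle_start x s n.+1 = (gen n, peak_age gen s n, s n).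
Proof.
move=> x0 xS; elim: n => [|n IHn].
  (* Both branches give [gen 0], because cycle [0] starts with age 0. *)
  by rewrite /= /next_peak/= x0 add0r; case: ifP; rewrite addr0.
have -> : cycle_start x s n.+2 =
  (next_peak (cycle_start x s n.+1) (x n.+1), s n.+1) by [].
by rewrite IHn /next_peak/= xS addrC subrK.
Qed.

Lemma measurable_next_peak :
  measurable_fun setT (fun z : ((R * R) * R) * R => next_peak z.1 z.2).
Proof. by rewrite /next_peak; measurability. Qed.

End renewal_cycles.

(** * Expected weights of the peaks and their recursions *)

Section random_cycles.
Context {d : measure_display} {T : measurableType d} {R : realType}.
Variables (P : probability T R) (a : R) (law : set R -> \bar R).
Variables (gen service : nat -> {RV P >-> R}) (sigma : R -> T -> option nat).
Hypotheses (a_gt0 : 0 < a) (law_lt0 : law [set x | x < 0] = 0%E)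
  (model : MG1_lcfsp a law gen service sigma).
Notation mu := (@lebesgue_measure R).

Let gap (n : nat) : T -> R := interarrival gen n.

Let start (n : nat) (w : T) := cycle_start (gap ^~ w) (service ^~ w) n.

Let clock (k : nat + nat) : T -> R :=
  match k with inl i => interarrival gen i | inr i => service i end.

Let indep_clock : mutually_independent P clock.
Proof. by case: model. Qed.

Let measurable_gap n : measurable_fun setT (gap n).
Proof. by case: n => [|n]; rewrite /gap /=; [|apply: measurable_funB]. Qed.

Let measurable_clock k : measurable_fun setT (clock k).
Proof. by case: k => n; [exact: measurable_gap|]. Qed.

Let gap_law n : has_law P (gap n) (exponential_prob a).
Proof. by case: model => -[+ _] _ _ _; exact. Qed.

Let startS n w : start n.+1 w =
  (gen n w, peak_age (gen ^~ w) (service ^~ w) n, service n w).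
Proof. exact: cycle_start_peak_age. Qed.

(** The clocks that [start n] has not read. *)
Let future (n : nat) : pred (nat + nat) := fun k =>
  match k with inl i => (n <= i)%N | inr i => (n <= i)%N end.

Let measurable_start n : measurable_fun setT (start n).
Proof.
elim: n => [|n IHn]; first exact: measurable_cst.
apply: measurable_fun_pair; last exact: measurable_funPT.
apply: (measurableT_comp measurable_next_peak (g := fun w => (start n w, gap n w))).
exact: measurable_fun_pair.
Qed.

(** Stops halfway through the update of the state: [gap n] has been read but [service n] has not, so
    the new peak is independent of the service time of the packet just generated. *)
Let indep_start_service n :
  independent_of_family P clock (start n) (future n) ->
  independent_of_family P clock (fun w => (start n.+1 w).1)
    [pred k | future n k & k != inl n].
Proof.
move=> h.
apply: (independent_of_family_comp _ _ (fun w => (start n w, clock (inl n) w))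
  _ _ _ measurable_next_peak).
by apply: independent_of_family_pair => //=.
Qed.

Let indep_start n : independent_of_family P clock (start n) (future n).
Proof.
elim: n => [|n IHn].
  move=> A s B mA us _ mB; have [A0|A0] := pselect (A (0, 0, 0)).
    rewrite (_ : start 0 @^-1` A = setT); last by apply/seteqP; split.
    by rewrite setTI probability_setT mul1e; exact: indep_clock.
  rewrite (_ : start 0 @^-1` A = set0); last by apply/seteqP; split.
  by rewrite set0I measure0 mul0e.
apply: (independent_of_family_sub _ _ _ [pred k |
  [pred k | future n k & k != inl n] k & k != inr n]).
  apply: (independent_of_family_pair _ _ _ _
    (fun w => (start n.+1 w).1) _ _ _ (inr n)) => //=.
  - exact: (measurableT_comp measurable_fst (measurable_start n.+1)).
  - exact: indep_start_service.
  - by rewrite leqnn.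
move=> k; rewrite !inE /= => nk; apply/andP; split; first (apply/andP; split).
- by case: k nk => i /= /ltnW.
- by apply/eqP => kn; move: nk; rewrite kn => nn; have := ltnn n; rewrite (nn : (n < n)%N).
- by apply/eqP => kn; move: nk; rewrite kn => nn; have := ltnn n; rewrite (nn : (n < n)%N).
Qed.

Let indep_start_gap n : independent2 P (start n) (gap n).
Proof. exact: (independent_of_family2 _ _ _ _ (indep_start n) (inl n) (leqnn n)). Qed.

Let indep_peak_service n : independent2 P (fun w => (start n.+1 w).1) (service n).
Proof.
apply: (independent_of_family2 _ _ _ _ (indep_start_service n (indep_start n)) (inr n)).
by rewrite /= leqnn.
Qed.

(** [exponential_law_pasta] with the state at the start of the cycle frozen by independence, once
    time is translated to that start. *)
Let cycle_pasta (g : R -> (R * R) * R -> R) n :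
  measurable_fun setT (fun z : R * ((R * R) * R) => g z.1 z.2) ->
  (forall v y, 0 <= g v y) ->
  (\int[P]_w \int[mu]_u
     (if ((start n w).1.1 <= u < (start n w).1.1 + gap n w)%R
      then g (u - (start n w).1.1) (start n w) else 0)%:E =
   a^-1%:E * \int[P]_w (g (gap n w) (start n w))%:E)%E.
Proof.
move=> mg g0.
have mg1 y : measurable_fun setT (g ^~ y).
  exact: measurableT_comp mg (measurable_pair2 y).
have mf : measurable_fun setT (fun z : (((R * R) * R) * R) * R =>
    if (0 <= z.2) && (z.2 < z.1.2) then g z.2 z.1.1 else 0).
  have mg' : measurable_fun setT
      (fun z : (((R * R) * R) * R) * R => g z.2 z.1.1).
    by apply: (measurableT_comp mg (g := fun z => (z.2, z.1.1))); measurability.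
  by measurability.
transitivity (\int[P]_w \int[mu]_v
    (if (0 <= v < gap n w)%R then g v (start n w) else 0)%:E)%E.
  apply: eq_integral => w _.
  set y := start n w.
  pose h u := (if (y.1.1 <= u < y.1.1 + gap n w)%R
    then g (u - y.1.1) y else 0)%:E.
  rewrite -(@ge0_integral_shift R y.1.1 h).
  - apply: eq_integral => v _; rewrite /h.
    by rewrite lerDl ltrD2l (addrC y.1.1 v) addrK.
  - have mgy := mg1 y.
    have mgy' : measurable_fun setT (fun u : R => g (u - y.1.1) y).
      by apply: (measurableT_comp mgy (g := fun u : R => u - y.1.1)); measurability.
    by rewrite /h; measurability.
  - by move=> x; rewrite lee_fin; case: ifP.
rewrite (ge0_integral_independent2 _ _ _ (measurable_start n) (measurable_gap n)
  (indep_start_gap n) (fun y x => \int[mu]_v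
    (if (0 <= v < x)%R then g v y else 0)%:E)%E); last 2 first.
- apply: (@measurable_fun_fubini_tonelli_F _ _ _ _ _ mu (fun z : (((R * R) * R) * R) * R =>
    (if (0 <= z.2) && (z.2 < z.1.2) then g z.2 z.1.1 else 0)%:E)).
  + exact/measurable_EFinP.
  + by move=> z; rewrite lee_fin; case: ifP.
- by move=> y x; apply: integral_ge0 => v _; rewrite lee_fin; case: ifP.
have mgs : measurable_fun setT (fun z : ((R * R) * R) * R => (g z.2 z.1)%:E).
  apply/measurable_EFinP.
  by apply: (measurableT_comp mg (g := fun z => (z.2, z.1))); measurability.
rewrite (ge0_integral_independent2 _ _ _ (measurable_start n) (measurable_gap n)
  (indep_start_gap n) (fun y x => (g x y)%:E))//;
  last by move=> y x; rewrite lee_fin.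
rewrite -ge0_integralZl//=; last 3 first.
- apply: (@measurable_fun_fubini_tonelli_F _ _ _ _ _ P
    (fun z : T * T => (g (gap n z.2) (start n z.1))%:E)).
  + apply/measurable_EFinP.
    apply: (measurableT_comp mg (g := fun z : T * T => (gap n z.2, start n z.1))).
    have := measurable_gap n; have := measurable_start n.
    by move=> ? ?; measurability.
  + by move=> z; rewrite lee_fin.
- by move=> w _; apply: integral_ge0 => w' _; rewrite lee_fin.
- by rewrite lee_fin invr_ge0 ltW.
apply: eq_integral => w _.
exact: (exponential_law_pasta _ _ _ a_gt0 (measurable_gap n) (gap_law n)).
Qed.


Definition before (tau u : R) : R := if u <= tau then 1 else 0.

Let measurable_before tau : measurable_fun setT (before tau).
Proof. by rewrite /before; measurability. Qed.

Let before_ge0 tau u : 0 <= before tau u.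
Proof. by rewrite /before; case: ifP. Qed.

(* The absolute value only matters on the null set where some [gen] decreases. *)
Definition peak_weight (wt : R -> R) (n : nat) : \bar R :=
  (\int[P]_w (wt (gen n w) * `|peak_age (gen ^~ w) (service ^~ w) n|)%:E)%E.

Definition arrival_weight (wt : R -> R) (n : nat) : \bar R :=
  (\int[P]_w (wt (gen n w))%:E)%E.

Let b n w := (start n w).1.1.

(** The part of a weighted integrand that lies in cycle [n]. Almost surely the cycles tile the
    half-line, so summing over [n] recovers the whole. *)
Let cell (g : R -> R) (h : R -> (R * R) * R -> R) n w u : R :=
  if b n w <= u < b n.+1 w then g u * h (u - b n w) (start n w) else 0.

(** At [v = gap n] this is, up to sign, the next peak: PASTA thereby turns the integral of the age
    into a sum of peaks. *)
Let age_in_cycle (v : R) (y : (R * R) * R) : R :=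
  `|v + (if y.2 <= v then 0 else y.1.2)|.

Let one_in_cycle (v : R) (y : (R * R) * R) : R := 1.

Let measurable_age_in_cycle :
  measurable_fun setT (fun z : R * ((R * R) * R) => age_in_cycle z.1 z.2).
Proof. by rewrite /age_in_cycle; measurability. Qed.

Let cell_weight (wt : R -> R) (h : R -> (R * R) * R -> R) n :
  measurable_fun setT wt -> (forall u, 0 <= wt u) ->
  measurable_fun setT (fun z : R * ((R * R) * R) => h z.1 z.2) ->
  (forall v y, 0 <= h v y) ->
  (\int[P]_w \int[mu]_u (cell wt h n w u)%:E =
   a^-1%:E * \int[P]_w (wt (gen n w) * h (gap n w) (start n w))%:E)%E.
Proof.
move=> mwt wt0 mh h0; pose g v (y : (R * R) * R) := wt (y.1.1 + v) * h v y.
have -> : (\int[P]_w (wt (gen n w) * h (gap n w) (start n w))%:E =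
    \int[P]_w (g (gap n w) (start n w))%:E)%E.
  apply: eq_integral => w _; congr (wt _ * _)%:E.
  exact/esym/(congr1 (fun y => y.1.1) (startS n w)).
rewrite -cycle_pasta.
- apply: eq_integral => w _; apply: eq_integral => u _.
  rewrite /cell /g /b -/(start n w); congr EFin.
  by rewrite [_ + (u - _)]addrC subrK.
- by rewrite /g; measurability.
- by move=> v y; rewrite mulr_ge0.
Qed.

Let cell_peak_weight (wt : R -> R) n :
  measurable_fun setT wt -> (forall u, 0 <= wt u) ->
  (\int[P]_w \int[mu]_u (cell wt age_in_cycle n w u)%:E =
   a^-1%:E * peak_weight wt n)%E.
Proof.
move=> mwt wt0; rewrite cell_weight//; last by move=> v y; exact: normr_ge0.
congr (_ * _)%E; apply: eq_integral => w _.
by have /= <- := congr1 (fun y : (R * R) * R => y.1.2) (startS n w).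
Qed.

Let cell_arrival_weight (wt : R -> R) n :
  measurable_fun setT wt -> (forall u, 0 <= wt u) ->
  (\int[P]_w \int[mu]_u (cell wt one_in_cycle n w u)%:E =
   a^-1%:E * arrival_weight wt n)%E.
Proof.
move=> mwt wt0; rewrite cell_weight//; congr (_ * _)%E.
by under eq_integral do rewrite mulr1.
Qed.

Let measurable_cell (wt : R -> R) (h : R -> (R * R) * R -> R) n :
  measurable_fun setT wt ->
  measurable_fun setT (fun z : R * ((R * R) * R) => h z.1 z.2) ->
  measurable_fun setT (fun z : T * R => (cell wt h n z.1 z.2)%:E).
Proof.
move=> mwt mh.
have mb k : measurable_fun setT (b k).
  by have := measurable_start k => mk; rewrite /b; measurability.
have mbn := mb n; have mbS := mb n.+1; have mn := measurable_start n.
have mh' : measurable_fun setT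
    (fun z : T * R => h (z.2 - b n z.1) (start n z.1)).
  apply: (measurableT_comp mh
    (g := fun z : T * R => (z.2 - b n z.1, start n z.1))).
  by measurability.
by rewrite /cell; measurability.
Qed.

Let cell_ge0 wt h : (forall u, 0 <= wt u) -> (forall v y, 0 <= h v y) ->
  forall n w u, 0 <= cell wt h n w u.
Proof. by move=> wt0 h0 n w u; rewrite /cell; case: ifP => // _; rewrite mulr_ge0. Qed.

Let measurable_sum_cell (wt : R -> R) (h : R -> (R * R) * R -> R) :
  measurable_fun setT wt -> (forall u, 0 <= wt u) ->
  measurable_fun setT (fun z : R * ((R * R) * R) => h z.1 z.2) ->
  (forall v y, 0 <= h v y) ->
  measurable_fun setT
    (fun w => \int[mu]_u \sum_(0 <= n <oo) (cell wt h n w u)%:E)%E.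
Proof.
move=> mwt wt0 mh h0.
apply: (@measurable_fun_fubini_tonelli_F _ _ _ _ _ mu
  (fun z : T * R => \sum_(0 <= n <oo) (cell wt h n z.1 z.2)%:E)%E).
- apply: ge0_emeasurable_sum => n; first by move=> z _ _; rewrite lee_fin cell_ge0.
  by move=> _; exact: measurable_cell.
- by move=> z; apply: nneseries_ge0 => n _ _; rewrite lee_fin cell_ge0.
Qed.

Let sum_cell (wt : R -> R) (h : R -> (R * R) * R -> R) :
  measurable_fun setT wt -> (forall u, 0 <= wt u) ->
  measurable_fun setT (fun z : R * ((R * R) * R) => h z.1 z.2) ->
  (forall v y, 0 <= h v y) ->
  (\sum_(0 <= n <oo) \int[P]_w \int[mu]_u (cell wt h n w u)%:E =
   \int[P]_w \int[mu]_u \sum_(0 <= n <oo) (cell wt h n w u)%:E)%E.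
Proof.
move=> mwt wt0 mh h0; rewrite -integral_nneseries//.
- apply: eq_integral => w _; rewrite -integral_nneseries// => n.
  + exact: measurableT_comp (measurable_cell _ _ _ mwt mh) (measurable_pair1 w).
  + by move=> u _; rewrite lee_fin cell_ge0.
- move=> n; apply: (@measurable_fun_fubini_tonelli_F _ _ _ _ _ mu
    (fun z : T * R => (cell wt h n z.1 z.2)%:E)); first exact: measurable_cell.
  by move=> z; rewrite lee_fin cell_ge0.
- by move=> n w _; apply: integral_ge0 => u _; rewrite lee_fin cell_ge0.
Qed.

Let good w := [/\ 0 < gen 0%N w, forall k, gen k w < gen k.+1 w,
  forall k, 0 <= service k w & lcfsp (gen ^~ w) (service ^~ w) (sigma ^~ w)].

Let ae_gap_gt0 n : {ae P, forall w, 0 < gap n w}.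
Proof.
exists [set w | gap n w <= 0]; split.
- by rewrite -[X in measurable X]setTI; exact: measurable_fun_le.
- rewrite (exponential_law_le _ _ _ (measurable_gap n) (gap_law n))//.
  by rewrite mulr0 expR0 subrr.
- by move=> w /= /negP; rewrite -leNgt.
Qed.

Let service_law n : has_law P (service n) law.
Proof. by case: model => _ [+ _] _ _; exact. Qed.

Let ae_service_ge0 n : {ae P, forall w, 0 <= service n w}.
Proof.
have mneg : measurable [set x : R | x < 0].
  have -> : [set x : R | x < 0] = `]-oo, 0[%classic.
    by apply/seteqP; split => x /=; rewrite in_itv.
  exact: measurable_itv.
exists (service n @^-1` [set x | x < 0]); split.
- by rewrite -[X in measurable X]setTI; exact: measurable_funPT.
- by rewrite service_law.
- by move=> w /= /negP; rewrite -ltNge.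
Qed.

Let ae_good : {ae P, forall w, good w}.
Proof.
have h1 := ae_foralln ae_gap_gt0; have h2 := ae_foralln ae_service_ge0.
have [_ _ _ h3] := model; have Pf := ae_filter_ringOfSetsType P.
apply: filterS3 h1 h2 h3 => w g0 s0 L; split=> //; first exact: (g0 0%N).
by move=> k; have := g0 k.+1; rewrite subr_gt0.
Qed.

Let bS n w : b n.+1 w = gen n w.
Proof. exact: (congr1 (fun y : (R * R) * R => y.1.1) (startS n w)). Qed.

Let b_lt w : good w -> forall n, b n w < b n.+1 w.
Proof. by case=> g0 gS _ _ [|n]; rewrite !bS. Qed.

Let b_le w : good w -> forall n m, (n <= m)%N -> b n w <= b m w.
Proof.
move=> gw n m; elim: m => [|m IHm]; first by rewrite leqn0 => /eqP ->.
by rewrite leq_eqVlt => /predU1P[->//|/IHm/le_trans]; apply; exact/ltW/b_lt.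
Qed.

Let cell_unique w u n m : good w -> b n w <= u < b n.+1 w ->
  b m w <= u < b m.+1 w -> n = m.
Proof.
move=> gw /andP[nu un] /andP[mu' um]; apply/eqP; rewrite eqn_leq; apply/andP.
by split; rewrite leqNgt; apply/negP => /(b_le _ gw) h; lra.
Qed.

Let sum_cellE wt h w u n : (forall u, 0 <= wt u) -> (forall v y, 0 <= h v y) ->
  good w -> b n w <= u < b n.+1 w ->
  (\sum_(0 <= m <oo) (cell wt h m w u)%:E)%E =
  (wt u * h (u - b n w) (start n w))%:E.
Proof.
move=> wt0 h0 gw nu; rewrite (@nneseriesD1 _ _ n)//; last first.
  by move=> k _; rewrite lee_fin cell_ge0.
rewrite eseries0 ?adde0 /cell ?nu// => m _ /= mn; case: ifPn => // mu'.
by rewrite (cell_unique _ _ _ _ gw nu mu') eqxx in mn.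
Qed.

Let sum_cell0 wt h w u : (forall n, ~~ (b n w <= u < b n.+1 w)) ->
  (\sum_(0 <= m <oo) (cell wt h m w u)%:E)%E = 0%E.
Proof. by move=> nu; apply: eseries0 => n _ _; rewrite /cell (negbTE (nu n)). Qed.

(** PASTA for the constant 1: [a^-1] times the expected number of arrivals is the expected length of
    the part of [[0, tau]] covered by cycles. Only an inequality, because the proof that the cycles
    exhaust the half-line rests on it. *)
Lemma arrivals_before (tau : R) : 0 <= tau ->
  (\sum_(0 <= n <oo) arrival_weight (before tau) n <= (a * tau)%:E)%E.
Proof.
move=> tau0; set wt := before tau.
have mwt : measurable_fun setT wt by exact: measurable_before.
have wt0 u : 0 <= wt u by exact: before_ge0.
have h0 v y : 0 <= one_in_cycle v y by exact: ler01.
have mh : measurable_fun setT (fun z : R * ((R * R) * R) => one_in_cycle z.1 z.2).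
  exact: measurable_cst.
have arr0 n : (0 <= arrival_weight wt n)%E.
  by apply: integral_ge0 => w _; rewrite lee_fin.
suff : (\sum_(0 <= n <oo) (a^-1%:E * arrival_weight wt n) <= tau%:E)%E.
  rewrite nneseriesZl// => h.
  have -> : (\sum_(0 <= n <oo) arrival_weight wt n)%E =
      (a%:E * (a^-1%:E * \sum_(0 <= n <oo) arrival_weight wt n))%E.
    by rewrite muleA -EFinM divff ?gt_eqF// mul1e.
  by rewrite EFinM; apply: lee_wpmul2l => //; rewrite lee_fin ltW.
under eq_eseriesr do rewrite -cell_arrival_weight//.
rewrite sum_cell//.
have -> : tau%:E = (\int[P]_w tau%:E)%E.
  rewrite integral_cst//; apply/esym.
  exact: (etrans (congr1 (mule _) (probability_setT P)) (mule1 _)).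
apply: ae_ge0_le_integral => //.
- move=> w _; apply: integral_ge0 => u _.
  by apply: nneseries_ge0 => n _ _; rewrite lee_fin cell_ge0.
- exact: measurable_sum_cell.
apply: filterS ae_good => w gw _.
have -> : tau%:E = (\int[mu]_u (\1_(`[0, tau]%classic : set R) u)%:E)%E.
  rewrite integral_indic// setIT; apply/esym.
  by apply: (etrans (lebesgue_measure_itvbb 0 tau true false tau0)); rewrite subr0.
apply: ge0_le_integral_nonmeasurable => u _.
  by apply: nneseries_ge0 => n _ _; rewrite lee_fin cell_ge0.
have [[n nu]|nu] := pselect (exists n, b n w <= u < b n.+1 w).
  rewrite (sum_cellE _ _ _ _ _ wt0 h0 gw nu) mulr1 lee_fin /wt /before indicE.
  rewrite mem_setE in_itv/= (le_trans (b_le _ gw 0 n isT))//=; last by case/andP: nu.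
  by case: ifP.
by rewrite sum_cell0 ?lee_fin// => n; apply/negP => h; apply: nu; exists n.
Qed.

(** Borel-Cantelli: the probabilities of [gen n <= m] have a sum of at most [a * m]. *)
Let ae_gen_unbounded : {ae P, forall w, forall m : nat, exists n, m%:R < gen n w}.
Proof.
apply: ae_foralln => m; pose F n := [set w | gen n w <= m%:R].
have mF n : measurable (F n).
  by rewrite -[F n]setTI; exact: measurable_fun_le.
exists (lim_sup_set F); split.
- by apply: bigcapT_measurable => n; exact: bigcup_measurable.
- apply: lim_sup_set_cvg0 => //.
  apply: (@le_lt_trans _ _ (a * m%:R)%:E); last by rewrite ltry.
  apply: le_trans (arrivals_before m%:R (ler0n _ _)); apply: lee_nneseries => // n _.
  rewrite /arrival_weight -[F n]setIT -integral_indic//.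
  apply: ge0_le_integral_nonmeasurable => w _; rewrite ?lee_fin// indicE.
  rewrite (_ : (w \in F n) = (gen n w <= m%:R)); last by apply/idP/idP; rewrite inE.
  by rewrite /before; case: (gen n w <= _).
- move=> w /= h n _; exists n => //=; rewrite /F/= leNgt; apply/negP => nm.
  by apply: h; exists n.
Qed.

(** Exact at each [tau]: the cut at [tau] belongs to the integrand, and PASTA evaluates it at the
    end of each cycle, leaving exactly the peaks with [gen n <= tau]. *)
Lemma average_age_before (tau : R) : 0 < tau ->
  (\int[P]_w (tau^-1%:E * \int[mu]_(u in `[0%R, tau])
      age (gen ^~ w) (service ^~ w) (sigma ^~ w) u) =
   tau^-1%:E * (a^-1%:E * \sum_(0 <= n <oo) peak_weight (before tau) n))%E.
Proof.
move=> tau0; have tau1 : (0 <= tau^-1%:E)%E by rewrite lee_fin invr_ge0 ltW.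
have h0 v y : 0 <= age_in_cycle v y by exact: normr_ge0.
have wt0 := before_ge0 tau; have mwt := measurable_before tau.
have S0 w : (0 <= \int[mu]_u \sum_(0 <= n <oo)
    (cell (before tau) age_in_cycle n w u)%:E)%E.
  apply: integral_ge0 => u _.
  by apply: nneseries_ge0 => n _ _; rewrite lee_fin cell_ge0.
have age0 w u : 0 <= u ->
    (0 <= age (gen ^~ w) (service ^~ w) (sigma ^~ w) u)%E.
  move=> u0; rewrite /age le_min lee_fin u0/=; apply: le_ereal_inf_tmp.
  by move=> _ [i [iu _] <-]; rewrite lee_fin subr_ge0.
rewrite -nneseriesZl//; last first.
  by move=> n _; apply: integral_ge0 => w _; rewrite lee_fin mulr_ge0.
under eq_eseriesr do rewrite -cell_peak_weight//.
rewrite sum_cell// -ge0_integralZl//; last exact: measurable_sum_cell.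
apply: ge0_ae_eq_integral_nonmeasurable.
- by apply: emeasurable_funM => //; exact: measurable_sum_cell.
- move=> w; apply: mule_ge0 => //; apply: integral_ge0 => u /=.
  by rewrite in_itv/= => /andP[u0 _]; exact: age0.
- by move=> w; exact: mule_ge0.
have Pf := ae_filter_ringOfSetsType P.
apply: filterS2 ae_good ae_gen_unbounded => w gw unb; congr (_ * _)%E.
rewrite integral_mkcond; apply: eq_integral => u _.
rewrite patchE mem_setE in_itv/=; case: ifPn => [/andP[u0 utau]|utau].
  have ex : exists n, u < b n w.
    have [n un] := unb (Num.bound u); exists n.+1.
    by rewrite bS (le_lt_trans _ un)// ltW// unstable.ltr_bound.
  (* The least such index is positive since [b 0 w] is 0, and its predecessor is the cycle
     containing [u]. *)
  case: (ex_minnP ex) => -[|n] un nmin.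
    by move: un; rewrite ltNge u0.
  have nu : b n w <= u < b n.+1 w.
    by rewrite un andbT leNgt; apply/negP => /nmin; rewrite ltnn.
  rewrite (sum_cellE _ _ _ _ _ wt0 h0 gw nu) /before utau mul1r.
  case: gw nu => g0 gS s0 L; case: n un {nmin} => [|n] un.
    rewrite bS => /andP[_ ug]; rewrite age_before_first//.
    by rewrite /b /age_in_cycle/= !subr0 u0 addr0 ger0_norm.
  rewrite !bS => /andP[gu ug]; rewrite (age_between _ _ _ g0 gS s0 L n)//.
  rewrite /age_in_cycle startS/= ger0_norm// addr_ge0 ?subr_ge0//.
  by case: ifP => // _; exact: peak_age_ge0.
have [u0|u0] := ltP u 0.
  rewrite sum_cell0// => n; apply/negP => /andP[nu _].
  by have := le_lt_trans (le_trans (b_le _ gw 0 n isT) nu) u0; rewrite ltxx.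
apply/esym/eseries0 => n _ _; rewrite /cell /before.
by move: utau; rewrite u0/= => /negbTE ->; rewrite mul0r; case: ifP.
Qed.

Let gapS k w : gap k.+1 w = gen k.+1 w - gen k w. Proof. by []. Qed.

Let mean_gap n (f : R -> R) : measurable_fun setT f -> (forall x, 0 <= f x) ->
  (\int[P]_w (f (gap n w))%:E = exponential_mean a f)%E.
Proof.
exact: (ge0_integral_exponential_law _ _ _ a_gt0 (measurable_gap n) (gap_law n)).
Qed.

Let mean_gap_weight (u : (R * R) * R -> R) (f : (R * R) * R -> R -> R) n :
  measurable_fun setT u -> (forall y, 0 <= u y) ->
  measurable_fun setT (fun z : ((R * R) * R) * R => f z.1 z.2) ->
  (forall y x, 0 <= f y x) ->
  (\int[P]_w (u (start n w) * f (start n w) (gap n w))%:E =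
   \int[P]_w ((u (start n w))%:E * exponential_mean a (f (start n w))))%E.
Proof.
move=> um u0 mf f0.
have mfy y : measurable_fun setT (f y).
  exact: (measurableT_comp mf (measurable_pair1 y)).
rewrite (ge0_integral_independent2 _ _ _ (measurable_start n) (measurable_gap n)
  (indep_start_gap n) (fun y x => (u y * f y x)%:E)); last 2 first.
- by measurability.
- by move=> y x; rewrite lee_fin mulr_ge0.
apply: eq_integral => w _.
rewrite -(mean_gap n)// -ge0_integralZl//=; last 3 first.
- apply/measurable_EFinP.
  exact: (measurableT_comp (mfy (start n w)) (measurable_gap n)).
- by move=> w' _; rewrite lee_fin.
- by rewrite lee_fin.
Qed.

Lemma arrival_weight_recursion (wt r : R -> R) k :
  measurable_fun setT wt -> (forall u, 0 <= wt u) ->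
  measurable_fun setT r -> (forall u, 0 <= r u) ->
  (\int[P]_w (wt (gen k w) * r (gap k.+1 w))%:E =
   arrival_weight wt k * exponential_mean a r)%E.
Proof.
move=> mwt wt0 mr r0.
transitivity (\int[P]_w (wt (start k.+1 w).1.1 * r (gap k.+1 w))%:E)%E.
  by apply: eq_integral => w _; rewrite startS.
rewrite (mean_gap_weight (fun y => wt y.1.1) (fun=> r)) => //; last 2 first.
- by measurability.
- by measurability.
rewrite muleC -ge0_integralZl//; last 3 first.
- by apply/measurable_EFinP; apply: (measurableT_comp mwt); exact: measurable_funPT.
- by move=> w _; rewrite lee_fin.
- exact: exponential_mean_ge0.
by apply: eq_integral => w _; rewrite startS muleC.
Qed.

(** The mean of [r] at an interarrival time, restricted to the preemption of packet [k]; for [r = 1]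
    it is the preemption probability. *)
Definition preemption_weight (r : R -> R) (k : nat) : \bar R :=
  (\int[P]_w exponential_mean a
     (fun v => if service k w <= v then 0 else r v)%R)%E.

(** Two independences give the products: the gap is independent of the whole state, and within the
    state [service k] is independent of the generation time and the peak. *)
Lemma peak_weight_recursion (wt r : R -> R) k :
  measurable_fun setT wt -> (forall u, 0 <= wt u) ->
  measurable_fun setT r -> (forall u, 0 <= r u) ->
  (\int[P]_w (wt (gen k w) * (r (gap k.+1 w) * (`|gap k.+1 w| +
      (if service k w <= gap k.+1 w then 0
       else `|peak_age (gen ^~ w) (service ^~ w) k|))))%R%:E =
   arrival_weight wt k * exponential_mean a (fun v => (r v * `|v|)%R) +
   peak_weight wt k * preemption_weight r k)%E.
Proof.
move=> mwt wt0 mr r0.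
have mgap := measurable_gap k.+1; have mstart := measurable_start k.+1.
pose c (s v : R) := if s <= v then 0 else r v.
have mc : measurable_fun setT (fun z : R * R => c z.1 z.2).
  by rewrite /c; measurability.
have c0 s v : 0 <= c s v by rewrite /c; case: ifP.
have mcv s : measurable_fun setT (c s).
  exact: (measurableT_comp mc (measurable_pair1 s)).
have mQ : measurable_fun setT (fun s => exponential_mean a (c s)).
  apply: (@measurable_fun_fubini_tonelli_F _ _ _ _ _ mu
    (fun z : R * R => (c z.1 z.2 * exponential_pdf a z.2)%:E)).
  - have mpdf := measurable_exponential_pdf a.
    by measurability.
  - by move=> z; rewrite lee_fin mulr_ge0// exponential_pdf_ge0// ltW.
pose u1 (y : (R * R) * R) := wt y.1.1.
pose u2 (y : (R * R) * R) := wt y.1.1 * `|y.1.2|.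
have mu1 : measurable_fun setT u1 by rewrite /u1; measurability.
have mu2 : measurable_fun setT u2 by rewrite /u2; measurability.
have u20 y : 0 <= u2 y by rewrite /u2 mulr_ge0.
have mcy : measurable_fun setT (fun z : ((R * R) * R) * R => c z.1.2 z.2).
  apply: (measurableT_comp mc (g := fun z : ((R * R) * R) * R => (z.1.2, z.2))).
  by measurability.
transitivity (\int[P]_w ((u1 (start k.+1 w) * (r (gap k.+1 w) * `|gap k.+1 w|))%:E +
    (u2 (start k.+1 w) * c (start k.+1 w).2 (gap k.+1 w))%:E))%E.
  apply: eq_integral => w _; rewrite -EFinD /u1 /u2 /c startS /=; congr EFin.
  by case: ifP => _; ring.
rewrite ge0_integralD//; last 4 first.
- by move=> w _; rewrite lee_fin mulr_ge0// ?mulr_ge0//; exact: wt0.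
- by measurability.
- by move=> w _; rewrite lee_fin mulr_ge0.
- have mcw : measurable_fun setT (fun w => c (start k.+1 w).2 (gap k.+1 w)).
    apply: (measurableT_comp mc (g := fun w => ((start k.+1 w).2, gap k.+1 w))).
    by measurability.
  by measurability.
congr (_ + _)%E.
  rewrite -arrival_weight_recursion//; last 2 first.
  - by measurability.
  - by move=> u; rewrite mulr_ge0.
  by apply: eq_integral => w _; rewrite /u1 startS.
rewrite (mean_gap_weight u2 (fun y => c y.2))//.
(* [u2] reads only the first two components, so 0 can fill the third once the service time is split
   off. *)
rewrite (ge0_integral_independent2 _ (fun w => (start k.+1 w).1) (service k) _ _
  (indep_peak_service k)
  (fun y s => (u2 (y, 0))%:E * exponential_mean a (c s))%E) => //; last 3 first.
- exact: (measurableT_comp measurable_fst mstart).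
- apply: emeasurable_funM.
    apply/measurable_EFinP.
    apply: (measurableT_comp mu2 (g := fun z : (R * R) * R => (z.1, 0 : R))).
    by measurability.
  by apply: (measurableT_comp mQ measurable_snd).
- by move=> y s; apply: mule_ge0; [rewrite lee_fin | exact: exponential_mean_ge0].
rewrite muleC /peak_weight -ge0_integralZl//; last 3 first.
- apply/measurable_EFinP.
  have := measurableT_comp mu2 mstart; congr (measurable_fun _ _).
  by apply/funext => w /=; rewrite startS.
- by move=> w _; rewrite lee_fin mulr_ge0.
- by apply: integral_ge0 => w _; exact: (exponential_mean_ge0 _ a_gt0 _ (c0 (service k w))).
apply: eq_integral => w _.
rewrite [RHS]muleC /preemption_weight startS/= -ge0_integralZl//.
- apply: (measurableT_comp mQ); exact: measurable_funPT.
- by move=> w' _; exact: (exponential_mean_ge0 _ a_gt0 _ (c0 (service k w'))).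
- by rewrite lee_fin mulr_ge0.
Qed.

(** Weakening [gen k.+1 <= tau] to [gen k <= tau] frees the last gap from the truncation, so that it
    can be averaged independently. *)
Lemma peak_weight_before_le (tau : R) k :
  (peak_weight (before tau) k.+1 <=
   arrival_weight (before tau) k * exponential_mean a (fun v => `|v|%R) +
   peak_weight (before tau) k * preemption_weight (cst 1%R) k)%E.
Proof.
have one0 (u : R) : 0 <= (cst 1 : R -> R) u by exact: ler01.
have m1 : measurable_fun setT (cst 1 : R -> R) by exact: measurable_cst.
have -> : (fun v : R => `|v|) = (fun v => (cst 1 : R -> R) v * `|v|).
  by apply/funext => v; rewrite /= mul1r.
rewrite -peak_weight_recursion//.
have mb k' : measurable_fun setT (fun w => before tau (gen k' w)).
  by apply: (measurableT_comp (measurable_before tau)); exact: measurable_funPT.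
have mbk := mb k; have mbS := mb k.+1; have mgap := measurable_gap k.+1.
have mpeak k' : measurable_fun setT
    (fun w => peak_age (gen ^~ w) (service ^~ w) k').
  have mstart := measurable_start k'.+1.
  have : measurable_fun setT (fun w => (start k'.+1 w).1.2) by measurability.
  by congr (measurable_fun _ _); apply/funext => w; rewrite startS.
have mpk := mpeak k; have mpS := mpeak k.+1.
have mserv : measurable_fun setT (service k) by exact: measurable_funPT.
apply: ae_ge0_le_integral => //.
- by move=> w _; rewrite lee_fin mulr_ge0.
- by measurability.
- by move=> w _; rewrite lee_fin !mulr_ge0// addr_ge0//; case: ifP.
- by measurability.
apply: filterS ae_good => w [g0 gS s0 _] _; rewrite lee_fin mul1r.
apply: ler_pM => //; first by rewrite /before; have := gS k; do 2 case: ifP => //; lra.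
by rewrite /=; case: ifP => _; rewrite ?addr0// ler_normD.
Qed.

Lemma arrival_weight_exp0 (eps : R) :
  arrival_weight (fun t => expR (- eps * t)) 0 =
  exponential_mean a (fun v => expR (- eps * v)).
Proof. by apply: (mean_gap 0) => [|x]; [measurability | exact: expR_ge0]. Qed.

Lemma arrival_weight_expS (eps : R) k :
  (arrival_weight (fun t => expR (- eps * t)) k.+1 =
   arrival_weight (fun t => expR (- eps * t)) k *
   exponential_mean a (fun v => expR (- eps * v)))%E.
Proof.
have m1 : measurable_fun setT (fun v : R => expR (- eps * v)) by measurability.
rewrite -arrival_weight_recursion//.
apply: eq_integral => w _; rewrite -expRD -mulrDr.
by congr (expR (_ * _))%:E; rewrite gapS addrC subrK.
Qed.

(** An equality, the weight at [gen k.+1] being the weight at [gen k] times a function of the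
    gap. *)
Lemma peak_weight_expS (eps : R) k :
  (peak_weight (fun t => expR (- eps * t)) k.+1 =
   arrival_weight (fun t => expR (- eps * t)) k *
     exponential_mean a (fun v => (expR (- eps * v) * `|v|)%R) +
   peak_weight (fun t => expR (- eps * t)) k *
     preemption_weight (fun v => expR (- eps * v)) k)%E.
Proof.
have m1 : measurable_fun setT (fun v : R => expR (- eps * v)) by measurability.
have e0 x : 0 <= expR (- eps * x) by exact: expR_ge0.
rewrite -peak_weight_recursion//.
have mgen : measurable_fun setT (gen k) by exact: measurable_funPT.
have mgap := measurable_gap k.+1; have mstart := measurable_start k.+1.
have mpk : measurable_fun setT (fun w => peak_age (gen ^~ w) (service ^~ w) k).
  have : measurable_fun setT (fun w => (start k.+1 w).1.2) by measurability.
  by congr (measurable_fun _ _); apply/funext => w; rewrite startS.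
have mserv : measurable_fun setT (service k) by exact: measurable_funPT.
apply: ge0_ae_eq_integral_nonmeasurable.
- by measurability.
- by move=> w; rewrite lee_fin mulr_ge0.
- by move=> w; rewrite lee_fin !mulr_ge0// addr_ge0//; case: ifP.
apply: filterS ae_good => w [g0 gS s0 _].
have gap0 : 0 <= gap k.+1 w by rewrite gapS subr_ge0 ltW.
rewrite (_ : gen k.+1 w = gen k w + gap k.+1 w); last by rewrite gapS addrC subrK.
rewrite mulrDr expRD -mulrA; congr (_ * (_ * _))%:E; rewrite /= -gapS.
have z0 := peak_age_ge0 _ (service ^~ w) g0 gS k.
rewrite (ger0_norm gap0); case: ifP => _; first by rewrite !addr0 ger0_norm.
by rewrite !ger0_norm// addr_ge0.
Qed.

(* [exp (- eps t)] is the probability that an independent exponential time of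
   rate [eps] exceeds [t]. *)
Lemma peak_weight_mixture (eps : R) : 0 < eps ->
  (\sum_(0 <= n <oo) peak_weight (fun t => expR (- eps * t)) n =
   \int[mu]_tau ((exponential_pdf eps tau)%:E *
     \sum_(0 <= n <oo) peak_weight (before tau) n))%E.
Proof.
move=> eps0; pose pk n w := `|peak_age (gen ^~ w) (service ^~ w) n|.
have pdf0 x : 0 <= exponential_pdf eps x by rewrite exponential_pdf_ge0// ltW.
have mpdf := measurable_exponential_pdf eps.
have mpk n : measurable_fun setT (pk n).
  have mstart := measurable_start n.+1.
  have : measurable_fun setT (fun w => `|(start n.+1 w).1.2|) by measurability.
  by congr (measurable_fun _ _); apply/funext => w; rewrite startS.
pose f n (tau : R) w := exponential_pdf eps tau * (before tau (gen n w) * pk n w).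
have pk0 n w : 0 <= pk n w by exact: normr_ge0.
have f0 n tau w : 0 <= f n tau w by rewrite /f mulr_ge0// mulr_ge0.
have mbefore n : measurable_fun setT (fun z : R * T => before z.1 (gen n z.2)).
  have mgen : measurable_fun setT (gen n) by exact: measurable_funPT.
  by rewrite /before; measurability.
have mf n : measurable_fun setT (fun z : R * T => f n z.1 z.2).
  have mb := mbefore n; have mpkn := mpk n.
  by rewrite /f; measurability.
have pull n tau : ((exponential_pdf eps tau)%:E * peak_weight (before tau) n =
    \int[P]_w (f n tau w)%:E)%E.
  have mbn : measurable_fun setT (fun w => before tau (gen n w)).
    exact: (measurableT_comp (mbefore n) (measurable_pair1 tau)).
  have mpkn := mpk n; rewrite -ge0_integralZl//.
  - have -> : (fun x : T => (before tau (gen n x) *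
        `|peak_age (gen ^~ x) (service ^~ x) n|)%:E) =
      (fun x => (before tau (gen n x) * pk n x)%:E) by [].
    by measurability.
  - by move=> w _; rewrite lee_fin mulr_ge0.
  - by rewrite lee_fin.
transitivity (\int[mu]_tau \sum_(0 <= n <oo) \int[P]_w (f n tau w)%:E)%E; last first.
  apply: eq_integral => tau _; rewrite -nneseriesZl.
    by apply: eq_eseriesr => n _; rewrite pull.
  by move=> n _; apply: integral_ge0 => w _; rewrite lee_fin mulr_ge0.
rewrite integral_nneseries//; last 2 first.
- move=> n; apply: (@measurable_fun_fubini_tonelli_F _ _ _ _ _ P
    (fun z : R * T => (f n z.1 z.2)%:E)); first exact/measurable_EFinP.
  by move=> z; rewrite lee_fin.
- by move=> n tau _; apply: integral_ge0 => w _; rewrite lee_fin.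
apply: eq_eseriesr => n _.
have mfE : measurable_fun setT (fun z : R * T => (f n z.1 z.2)%:E).
  exact/measurable_EFinP.
rewrite (@tonelli _ _ _ _ _ mu P (fun tau w => (f n tau w)%:E)); last 2 first.
- exact: mfE.
- by move=> tau w; rewrite lee_fin.
apply: ge0_ae_eq_integral_nonmeasurable.
- apply: (@measurable_fun_fubini_tonelli_G _ _ _ _ _ mu
    (fun z : R * T => (f n z.1 z.2)%:E)); first exact: mfE.
  by move=> z; rewrite lee_fin.
- by move=> w; rewrite lee_fin mulr_ge0// expR_ge0.
- by move=> w; apply: integral_ge0 => tau _; rewrite lee_fin.
apply: filterS ae_good => w gw.
have gen0 : 0 <= gen n w by have := b_le _ gw 0 n.+1 isT; rewrite bS.
rewrite mulrC EFinM -(exponential_mean_ge _ eps0 _ gen0) -ge0_integralZl//.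
- by apply: eq_integral => tau _; rewrite -EFinM /f /pk /before; congr EFin; ring.
- by measurability.
- by move=> tau _; rewrite lee_fin mulr_ge0//; case: ifP.
Qed.

Lemma peak_weight_ge0 (wt : R -> R) n : (forall u, 0 <= wt u) ->
  (0 <= peak_weight wt n)%E.
Proof. by move=> wt0; apply: integral_ge0 => w _; rewrite lee_fin mulr_ge0. Qed.

Lemma arrival_weight_ge0 (wt : R -> R) n : (forall u, 0 <= wt u) ->
  (0 <= arrival_weight wt n)%E.
Proof. by move=> wt0; apply: integral_ge0 => w _; rewrite lee_fin. Qed.

Lemma peak_weight_before0 (tau : R) :
  (peak_weight (before tau) 0 <= exponential_mean a (fun v => `|v|%R))%E.
Proof.
rewrite -(mean_gap 0)//; apply: ge0_le_integral_nonmeasurable => w _.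
  by rewrite lee_fin mulr_ge0.
by rewrite lee_fin /before /=; case: ifP; rewrite ?mul1r ?mul0r.
Qed.

Lemma peak_weight_before_nd (tau tau' : R) n : tau <= tau' ->
  (peak_weight (before tau) n <= peak_weight (before tau') n)%E.
Proof.
move=> tt; apply: ge0_le_integral_nonmeasurable => w _.
  by rewrite lee_fin mulr_ge0.
rewrite lee_fin ler_wpM2r// /before; case: ifP => [h|_]; last by case: ifP.
by rewrite (le_trans h tt).
Qed.

(** [law] is a bare set function; [Q] is a measure that agrees with it on measurable sets and
    against which one can integrate. *)
Lemma preemption_weight_law (Q : probability (measurableTypeR R) R) (r : R -> R) n :
  (forall A, measurable A -> Q A = law A) ->
  measurable_fun setT r -> (forall x, 0 <= r x) ->
  preemption_weight r n =
  (\int[Q]_s exponential_mean a (fun v => if s <= v then 0 else r v)%R)%E.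
Proof.
move=> QE mr r0; have mc : measurable_fun setT
    (fun z : R * R => ((if z.1 <= z.2 then 0 else r z.2) * exponential_pdf a z.2)%:E).
  by have mpdf := measurable_exponential_pdf a; measurability.
pose S : T -> measurableTypeR R := service n.
have mS : measurable_fun setT S by exact: (measurable_funPT (service n)).
pose F (s : measurableTypeR R) :=
  exponential_mean a (fun v => if s <= v then 0 else r v)%R.
have mF : measurable_fun setT F.
  apply: (@measurable_fun_fubini_tonelli_F _ _ _ _ _ mu _ mc).
  move=> z; rewrite lee_fin mulr_ge0//; first by case: ifP.
  by rewrite exponential_pdf_ge0// ltW.
have := @ge0_integral_pushforward _ _ _ _ R S mS P setT F measurableT mF.
rewrite preimage_setT => h; transitivity (\int[pushforward P S]_s F s)%E.
  by rewrite h// => s _; apply: exponential_mean_ge0 => // v; case: ifP.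
by apply: eq_measure_integral => A mA _; exact: etrans (service_law n _ mA) (esym (QE _ mA)).
Qed.

End random_cycles.

(** * Splitting a series and letting a parameter tend to 0 *)

Lemma nneseries_recl1 {R : realType} (f : nat -> \bar R) : (forall n, 0 <= f n)%E ->
  (\sum_(0 <= n <oo) f n = f 0%N + \sum_(0 <= n <oo) f n.+1)%E.
Proof.
move=> f0; rewrite (nneseries_split 0 1)// add0n big_nat1; congr (_ + _)%E.
rewrite -(nneseries_addn 1)//; apply: eq_eseriesr => n _.
by rewrite addn1.
Qed.

Lemma le_of_forall_small {R : realType} (x y B : R) : 0 <= B ->
  (forall e, 0 < e -> e <= 1 -> x <= y + e * B) -> x <= y.
Proof.
move=> B0 h; apply/ler_addgt0Pr => d d0.
have B1 : 0 < B + 1 by lra.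
have dB : 0 < d / (B + 1) by rewrite divr_gt0.
have [dB1|dB1] := leP (d / (B + 1)) 1.
  apply: le_trans (h _ dB dB1) _; rewrite lerD2l.
  by rewrite mulrAC ler_pdivrMr// ler_wpM2l ?ltW//; lra.
apply: le_trans (h 1 ltr01 (lexx _)) _; rewrite lerD2l mul1r.
by move: dB1; rewrite ltr_pdivlMr// mul1r; lra.
Qed.

(** * Upper bound for a general service law of mean [D] *)

Section upper_bound.
Context {d : measure_display} {T : measurableType d} {R : realType}.
Variables (P : probability T R) (a D : R).
Variable FS : probability (measurableTypeR R) R.
Variables (gen service : nat -> {RV P >-> R}) (sigma : R -> T -> option nat).
Hypotheses (a_gt0 : 0 < a) (D_gt0 : 0 < D).
Hypotheses (FS_lt0 : FS [set x | x < 0] = 0%E) (FS_mean : (\int[FS]_x x%:E = D%:E)%E).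
Hypothesis model : MG1_lcfsp a FS gen service sigma.
Notation mu := (@lebesgue_measure R).

(** The probability that a packet of service time [D] escapes preemption. *)
Let p := expR (- (a * D)).

Let p_gt0 : 0 < p. Proof. exact: expR_gt0. Qed.

Let integral_norm_FS : (\int[FS]_x `|x|%:E = D%:E)%E.
Proof.
rewrite -FS_mean; apply: ae_eq_integral => //.
- by apply/measurable_EFinP; exact: (@normr_measurable R setT).
exists [set x : R | x < 0]; split => //.
  have -> : [set x : R | x < 0] = `]-oo, 0[%classic.
    by apply/seteqP; split => x /=; rewrite in_itv.
  exact: measurable_itv.
move=> x /=; rewrite ltNge; apply: contra_notN => x0 _.
by rewrite ger0_norm.
Qed.

(* Jensen: [1 - exp (- a s)] lies below its tangent line at [s = D]. *)
Lemma preemption_weight_le n :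
  (preemption_weight P a service (cst 1%R) n <= (1 - p)%:E)%E.
Proof.
have m1 : measurable_fun setT (cst 1 : R -> R) by exact: measurable_cst.
have one0 (x : R) : 0 <= (cst 1 : R -> R) x by exact: ler01.
rewrite (preemption_weight_law _ _ _ _ _ _ a_gt0 model FS _ _ _ m1 one0)//.
have aD0 : 0 < a * D by rewrite mulr_gt0.
have pE : p * expR (a * D) = 1 by rewrite /p -expRD addNr expR0.
have c0 : 0 <= 1 - p * (1 + a * D).
  have -> : 1 - p * (1 + a * D) = p * (expR (a * D) - (1 + a * D)).
    by rewrite [RHS]mulrBr pE.
  by rewrite mulr_ge0 ?(ltW p_gt0)// subr_ge0 expR_ge1Dx.
have c1 : 0 <= p * a by rewrite mulr_ge0 ?(ltW p_gt0)// ltW.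
have mn : measurable_fun setT (fun s : measurableTypeR R => `|s|%:E).
  by apply/measurable_EFinP; exact: (@normr_measurable R setT).
(* The tangent line, with intercept and slope shown nonnegative; [|s|], almost surely equal to [s],
   keeps the integrand nonnegative everywhere. *)
have -> : ((1 - p)%:E = \int[FS]_s ((1 - p * (1 + a * D))%:E + (p * a)%:E * `|s|%:E))%E.
  rewrite ge0_integralD//=; last 2 first.
  - by move=> s _; rewrite lee_fin mulr_ge0.
  - by apply: emeasurable_funM => //; exact: measurable_cst.
  rewrite ge0_integralZl// integral_norm_FS integral_cst//.
  rewrite [X in _ = (_ * X + _)%E](_ : _ = 1%E); last exact: probability_setT.
  by rewrite mule1 -EFinM -EFinD; congr EFin; ring.
apply: ge0_le_integral_nonmeasurable => s _.
  by apply: exponential_mean_ge0 => // v; case: ifP.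
have [s0|s0] := leP 0 s; last first.
  rewrite (_ : exponential_mean _ _ = 0%E).
    by rewrite -EFinM -EFinD lee_fin addr_ge0// mulr_ge0.
  apply: integral0_eq => v _; have [v0|v0] := leP 0 v.
    by rewrite (le_trans (ltW s0) v0) mul0r.
  by rewrite lt0_exponential_pdf// mulr0.
rewrite exponential_mean_lt// -EFinM -EFinD lee_fin ger0_norm//.
have -> : expR (- a * s) = p * expR (- a * (s - D)).
  by rewrite /p -expRD; congr expR; ring.
have := ler_wpM2l (ltW p_gt0) (expR_ge1Dx (- a * (s - D))).
have -> : p * (1 + - a * (s - D)) = p * (1 + a * D) - p * a * s by ring.
by move: (p * expR _) (p * (1 + _)) (p * a * s) => x y z; lra.
Qed.

(** The sum [W] satisfies [W <= a^-1 + tau + (1 - p) * W]: [a^-1] bounds the first peak, and [tau]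
    is [a^-1] times the bound on the expected arrivals. Induction on partial sums replaces solving
    for [W], which might be infinite. *)
Lemma sum_peak_weight_le (tau : R) : 0 <= tau ->
  (\sum_(0 <= n <oo) peak_weight P gen service (before tau) n <=
   ((a^-1 + tau) / p)%:E)%E.
Proof.
move=> tau0.
have b0 (u : R) : 0 <= before tau u by rewrite /before; case: ifP.
have pk0 n := peak_weight_ge0 P gen service _ n b0.
have ar0 n := arrival_weight_ge0 P gen _ n b0.
have p1 : 0 <= 1 - p.
  by rewrite subr_ge0 /p -expR0 ler_expR oppr_le0 mulr_ge0// ltW.
have K0 : 0 <= a^-1 + tau by rewrite addr_ge0// invr_ge0 ltW.
have partial n : (\sum_(0 <= k < n) peak_weight P gen service (before tau) k <=
    ((a^-1 + tau) / p)%:E)%E.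
  elim: n => [|n IHn]; first by rewrite big_geq// lee_fin divr_ge0// ltW.
  rewrite big_nat_recl//.
  apply: (@le_trans _ _ (a^-1%:E + \sum_(0 <= k < n)
     (a^-1%:E * arrival_weight P gen (before tau) k +
      (1 - p)%:E * peak_weight P gen service (before tau) k)))%E.
    apply: leeD.
      rewrite -(exponential_mean_norm _ a_gt0).
      exact: (peak_weight_before0 _ _ _ _ _ _ a_gt0 model).
    apply: lee_sum => k _.
    apply: le_trans (peak_weight_before_le _ _ _ _ _ _ a_gt0 FS_lt0 model tau k) _.
    rewrite exponential_mean_norm// muleC; apply: leeD => //.
    by rewrite muleC; apply: lee_wpmul2r => //; exact: preemption_weight_le.
  rewrite big_split/= -!ge0_sume_distrr//.
  have arr : (\sum_(0 <= k < n) arrival_weight P gen (before tau) k <= (a * tau)%:E)%E.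
    apply: le_trans (arrivals_before _ _ _ _ _ _ a_gt0 FS_lt0 model _ tau0).
    exact: nneseries_lim_ge.
  apply: (@le_trans _ _ (a^-1%:E + (a^-1%:E * (a * tau)%:E +
    (1 - p)%:E * ((a^-1 + tau) / p)%:E)))%E.
    apply: leeD => //; apply: leeD; apply: lee_wpmul2l => //.
    by rewrite lee_fin invr_ge0 ltW.
  rewrite -!EFinM -!EFinD lee_fin le_eqVlt; apply/orP; left; apply/eqP.
  by field; rewrite !gt_eqF.
apply: lime_le; first exact: is_cvg_nneseries.
exact: nearW.
Qed.

Lemma average_age_upper :
  (average_age P gen service sigma <= ((a * p)^-1)%:E)%E.
Proof.
(* At [tau] the bound exceeds the limit by [(a * a * p)^-1 / tau], which is at most [e] beyond
   [M]. *)
apply/lee_addgt0Pr => e e0; pose M := (a * a * p * e)^-1.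
have M0 : 0 < M by rewrite invr_gt0 !mulr_gt0.
apply: ereal_inf_le; exists (ereal_sup [set (\int[P]_w ((tau^-1)%:E *
       \int[lebesgue_measure]_(u in `[0%R, tau])
          age (gen ^~ w) (service ^~ w) (sigma ^~ w) u))%E | tau in [set tau | M < tau]]).
  by exists [set tau | M < tau] => //; exists M; split => //; exact: num_real.
apply: ge_ereal_sup => _ [tau /= Mtau <-].
have tau0 : 0 < tau by exact: lt_trans Mtau.
rewrite (average_age_before _ _ _ _ _ _ a_gt0 FS_lt0 model _ tau0).
apply: (@le_trans _ _ (tau^-1%:E * (a^-1%:E * ((a^-1 + tau) / p)%:E))%E).
  apply: lee_wpmul2l; first by rewrite lee_fin invr_ge0 ltW.
  apply: lee_wpmul2l; first by rewrite lee_fin invr_ge0 ltW.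
  exact: sum_peak_weight_le (ltW tau0).
rewrite -!EFinM -EFinD lee_fin.
have -> : tau^-1 * (a^-1 * ((a^-1 + tau) / p)) = (a * p)^-1 + (a * a * p)^-1 / tau.
  by field; rewrite !gt_eqF.
rewrite lerD2l ler_pdivrMr//.
apply: le_trans (ler_wpM2l (ltW e0) (ltW Mtau)).
by rewrite /M le_eqVlt; apply/orP; left; apply/eqP; field; rewrite !gt_eqF.
Qed.

End upper_bound.

(** * Lower bound for deterministic service *)

Section lower_bound.
Context {d : measure_display} {T : measurableType d} {R : realType}.
Variables (P : probability T R) (a D : R).
Variables (gen service : nat -> {RV P >-> R}) (sigma : R -> T -> option nat).
Hypotheses (a_gt0 : 0 < a) (D_gt0 : 0 < D).
Hypothesis model : MG1_lcfsp a (\d_D) gen service sigma.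
Notation mu := (@lebesgue_measure R).

Let p := expR (- (a * D)).

Let dirac_lt0 : \d_D [set x : R | x < 0] = 0%E :> \bar R.
Proof. by rewrite diracE memNset//= => /lt_trans /(_ D_gt0); rewrite ltxx. Qed.

Lemma preemption_weight_dirac (r : R -> R) n : measurable_fun setT r ->
  (forall x, 0 <= r x) ->
  preemption_weight P a service r n =
  exponential_mean a (fun v => if D <= v then 0 else r v).
Proof.
move=> mr r0.
rewrite (preemption_weight_law _ _ _ _ _ _ a_gt0 model
  (@dirac _ (measurableTypeR R) D R))//.
rewrite integral_dirac//; last first.
  apply: (@measurable_fun_fubini_tonelli_F _ _ _ _ _ mu
    (fun z : R * R => ((if z.1 <= z.2 then 0 else r z.2) * exponential_pdf a z.2)%:E)).
    by have mpdf := measurable_exponential_pdf a; measurability.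
  move=> z; rewrite lee_fin mulr_ge0//; first by case: ifP.
  by rewrite exponential_pdf_ge0// ltW.
by rewrite diracT mul1e.
Qed.

(** Summing the discounted recursions gives linear relations between the sum of arrival weights and
    that of peak weights. The bound [c] makes the latter finite, hence also the former, so that
    terms may be moved across. *)
Lemma sum_peak_weight_exp_ge (eps c : R) : 0 < eps ->
  (\sum_(0 <= n <oo) peak_weight P gen service (fun t => expR (- eps * t)) n
    <= c%:E)%E ->
  a ^+ 2 / (eps * (a + eps) * (eps + a * expR (- (a + eps) * D))) <= c.
Proof.
move=> eps0; set pk := peak_weight P gen service _.
pose ar := arrival_weight P gen (fun t => expR (- eps * t)).
have e0 (x : R) : 0 <= expR (- eps * x) by exact: expR_ge0.
have me : measurable_fun setT (fun x : R => expR (- eps * x)) by measurability.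
have pk0 n : (0 <= pk n)%E by exact: peak_weight_ge0.
have ar0 n : (0 <= ar n)%E by exact: arrival_weight_ge0.
have ae0 : 0 < a + eps by rewrite addr_gt0.
have ane : a + eps != 0 by rewrite gt_eqF.
(* [rho] is the Laplace transform of a gap at [eps], and [E] the probability that an exponential
   time of rate [a + eps] exceeds [D]. *)
pose rho := a / (a + eps); pose E := expR (- (a + eps) * D).
have rhoE : exponential_mean a (fun v => expR (- eps * v)) = rho%:E.
  transitivity (exponential_mean a (fun v => expR (- eps * v) * (cst 1 : R -> R) v)).
    by congr exponential_mean; apply/funext => v; rewrite mulr1.
  have m1 : measurable_fun setT (cst 1 : R -> R) by exact: measurable_cst.
  have one0 (x : R) : 0 <= (cst 1 : R -> R) x by exact: ler01.
  rewrite (exponential_mean_tilt _ a_gt0 _ _ (ltW eps0) m1 one0).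
  by apply: etrans (congr1 (mule _) (exponential_mean1 _ ae0)) _; rewrite mule1.
have alphaE : exponential_mean a (fun v => expR (- eps * v) * `|v|) =
    (rho / (a + eps))%:E.
  have mn : measurable_fun setT (fun v : R => `|v|) by exact: (@normr_measurable R setT).
  rewrite (exponential_mean_tilt _ a_gt0 _ _ (ltW eps0) mn (@normr_ge0 _ R)).
  by apply: etrans (congr1 (mule _) (exponential_mean_norm _ ae0)) _.
have qE n : preemption_weight P a service (fun v => expR (- eps * v)) n =
    (rho * (1 - E))%:E.
  rewrite preemption_weight_dirac//.
  transitivity (exponential_mean a
      (fun v => expR (- eps * v) * (if D <= v then 0 else 1))).
    by congr exponential_mean; apply/funext => v; case: ifP; rewrite ?mulr0 ?mulr1.
  have mD : measurable_fun setT (fun v : R => if D <= v then 0 else 1 : R).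
    by measurability.
  have D0 (v : R) : 0 <= (if D <= v then 0 else 1 : R) by case: ifP.
  rewrite (exponential_mean_tilt _ a_gt0 _ _ (ltW eps0) mD D0).
  exact: (congr1 (mule _) (exponential_mean_lt _ _ (ltW D_gt0))).
have rho0 : 0 < rho by rewrite divr_gt0.
have E1 : E < 1.
  by rewrite /E -expR0 ltr_expR mulNr oppr_lt0 mulr_gt0.
have E0 : 0 < E by exact: expR_gt0.
have arM : (\sum_(0 <= n <oo) ar n = rho%:E + rho%:E * \sum_(0 <= n <oo) ar n)%E.
  rewrite {1}nneseries_recl1//; congr (_ + _)%E.
    by rewrite /ar (arrival_weight_exp0 _ _ _ _ _ _ a_gt0 model).
  rewrite -nneseriesZl//; apply: eq_eseriesr => n _.
  by rewrite /ar (arrival_weight_expS _ _ _ _ _ _ a_gt0 model) rhoE muleC.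
(* The first peak is dropped: it stays bounded as [eps] tends to 0, while the sum is of order
   [1 / eps]. *)
have pkW : ((rho / (a + eps))%:E * \sum_(0 <= n <oo) ar n +
    (rho * (1 - E))%:E * \sum_(0 <= n <oo) pk n <= \sum_(0 <= n <oo) pk n)%E.
  rewrite [leRHS]nneseries_recl1// -!nneseriesZl// -nneseriesD; last 2 first.
  - by move=> n _ _; rewrite mule_ge0// lee_fin divr_ge0// ltW.
  - by move=> n _ _; rewrite mule_ge0// lee_fin mulr_ge0 ?subr_ge0// ltW.
  rewrite -[leLHS]add0e; apply: leeD => //.
  apply: lee_nneseries => n _.
    move=> _; apply: adde_ge0; rewrite mule_ge0// lee_fin.
      by rewrite divr_ge0// ltW.
    by rewrite mulr_ge0 ?subr_ge0// ltW.
  rewrite [leRHS]/pk (peak_weight_expS _ _ _ _ _ _ a_gt0 dirac_lt0 model) alphaE qE.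
  by rewrite muleC; apply: leeD => //; rewrite muleC.
have W0 : (0 <= \sum_(0 <= n <oo) pk n)%E by exact: nneseries_ge0.
have M0 : (0 <= \sum_(0 <= n <oo) ar n)%E by exact: nneseries_ge0.
move: W0 M0 arM pkW.
case: (\sum_(0 <= n <oo) pk n)%E => [w| |]//.
have rae0 : 0 < rho / (a + eps) by rewrite divr_gt0.
case: (\sum_(0 <= n <oo) ar n)%E => [m| |]//; last first.
  by move=> _ _ _; rewrite gt0_muley ?lte_fin// -EFinM addye// leye_eq.
rewrite -!EFinM -!EFinD !lee_fin => w0 m0 [mE] wE wc.
have mE' : m = a / eps.
  have : m * (1 - rho) = rho by rewrite mulrBr mulr1 {1}mE; ring.
  have -> : 1 - rho = eps / (a + eps) by rewrite /rho; field.
  move=> h; have : m * eps = a.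
    have := congr1 ( *%R^~ (a + eps)) h; rewrite /= /rho.
    by rewrite -!mulrA !(mulVf ane) !mulr1.
  by move=> <-; field; rewrite gt_eqF.
apply: le_trans wc; rewrite ler_pdivrMr; last first.
  by rewrite !mulr_gt0// addr_gt0// mulr_gt0.
have : rho / (a + eps) * m <= w * (1 - rho * (1 - E)) by lra.
have -> : rho / (a + eps) * m = a ^+ 2 / (eps * (a + eps) ^+ 2).
  by rewrite mE' /rho; field; rewrite ane gt_eqF.
have -> : 1 - rho * (1 - E) = (eps + a * E) / (a + eps) by rewrite /rho; field.
rewrite ler_pdivrMr; last by rewrite mulr_gt0// exprn_gt0.
rewrite -/E; have -> : w * ((eps + a * E) / (a + eps)) * (eps * (a + eps) ^+ 2) =
  w * (eps * (a + eps) * (eps + a * E)) by field.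
by [].
Qed.

Lemma average_age_lower :
  (((a * p)^-1)%:E <= average_age P gen service sigma)%E.
Proof.
have p0 : 0 < p by exact: expR_gt0.
have b0 (tau u : R) : 0 <= before tau u by rewrite /before; case: ifP.
pose U tau := (\sum_(0 <= n <oo) peak_weight P gen service (before tau) n)%E.
have U0 tau : (0 <= U tau)%E.
  by apply: nneseries_ge0 => n _ _; exact: peak_weight_ge0.
apply: le_ereal_inf_tmp => _ [V [M [_ MV]] <-]; set S := ereal_sup _.
(* From [K] on, [tau] is both beyond [M] and positive. *)
pose K := Num.max M 0 + 1.
have K0 : 0 < K by rewrite ltr_wpDl// le_max lexx orbT.
have MK tau : K <= tau -> M < tau.
  by apply: lt_le_trans; rewrite (@le_lt_trans _ _ (Num.max M 0)) ?le_max ?lexx// ltrDl.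
have US tau : K <= tau -> (tau^-1%:E * (a^-1%:E * U tau) <= S)%E.
  move=> Ktau; have tau0 : 0 < tau by exact: lt_le_trans Ktau.
  rewrite -(average_age_before _ _ _ _ _ _ a_gt0 dirac_lt0 model _ tau0).
  by apply: ereal_sup_ubound; exists tau => //; apply: MV; exact: MK.
have S0 : (0 <= S)%E.
  apply: le_trans (US K (lexx _)).
  apply: mule_ge0; first by rewrite lee_fin invr_ge0 (ltW K0).
  by apply: mule_ge0 => //; rewrite lee_fin invr_ge0 (ltW a_gt0).
case: S S0 US => [c| |]//; last by move=> _ _; exact: leey.
rewrite lee_fin => c0 US; rewrite lee_fin.
(* The mixture runs over all [tau >= 0], but [US] applies only from [K] on: monotonicity of [U] and
   the bound at [K + tau] cover the rest. *)
have Ule tau : 0 <= tau -> (U tau <= (a * c * K + a * c * tau)%:E)%E.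
  move=> tau0; apply: (@le_trans _ _ (U (K + tau))).
    apply: lee_nneseries => n _; first by move=> _; exact: peak_weight_ge0.
    by apply: peak_weight_before_nd; rewrite lerDr ltW.
  have Kt : 0 < K + tau by rewrite ltr_wpDr.
  have := US (K + tau); rewrite lerDl => /(_ tau0).
  case: (U (K + tau)) (U0 (K + tau)) => [u| |]//.
    move=> _; rewrite -!EFinM !lee_fin.
    rewrite ler_pdivrMl// ler_pdivrMl// => h; apply: le_trans h _.
    by rewrite le_eqVlt; apply/orP; left; apply/eqP; ring.
  by rewrite !gt0_muley ?lte_fin ?invr_gt0//.
(* The form that the inequality for the mixture takes at [e = 0]. *)
suff : a <= c * a * (a * p).
  move=> h; rewrite -[leLHS]mul1r ler_pdivrMr ?mulr_gt0// -(ler_pM2l a_gt0) mulr1.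
  by rewrite mulrA [a * c]mulrC.
(* Expanding [c * (K * e + 1) * (a + e) * (e + a * p)] and bounding the higher powers of [e] by [e],
   as [e <= 1] allows, leaves [c * a * (a * p) + e * B]. *)
pose B := c * (a + 1 + a * p + K * (a + a ^+ 2 * p + 1 + a * p)).
have B0 : 0 <= B.
  have ap0 : 0 <= a * p by rewrite mulr_ge0// ltW.
  have aap0 : 0 <= a ^+ 2 * p by rewrite mulr_ge0 ?sqr_ge0// ltW.
  have a0 := ltW a_gt0; have K0' := ltW K0.
  apply: mulr_ge0 => //; apply: addr_ge0; first by rewrite !addr_ge0.
  by apply: mulr_ge0 => //; rewrite !addr_ge0.
apply: (@le_of_forall_small _ _ _ B) => // e e0 e1.
have : (\sum_(0 <= n <oo) peak_weight P gen service (fun t => expR (- e * t)) n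
    <= (a * c * K + a * c * e^-1)%:E)%E.
  rewrite (peak_weight_mixture _ _ _ _ _ _ dirac_lt0 model _ e0).
  have ac0 : 0 <= a * c by rewrite mulr_ge0// ltW.
  have acK0 : 0 <= a * c * K by rewrite mulr_ge0// ltW.
  have mn : measurable_fun setT (fun v : R => `|v|) by exact: (@normr_measurable R setT).
  apply: (@le_trans _ _ (exponential_mean e
     (fun v => a * c * K * (cst 1 : R -> R) v + a * c * `|v|))).
    apply: ge0_le_integral_nonmeasurable => tau _.
      apply: mule_ge0; last exact: U0.
      by rewrite lee_fin exponential_pdf_ge0// ltW.
    have [tau0|tau0] := leP 0 tau; last first.
      by rewrite lt0_exponential_pdf// mul0e mulr0.
    rewrite mulrC EFinM ger0_norm// mulr1; apply: lee_wpmul2l; last exact: Ule.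
    by rewrite lee_fin exponential_pdf_ge0// ltW.
  rewrite exponential_meanD//; first 1 last.
  - by measurability.
  - by move=> x; rewrite mulr_ge0// ler01.
  - by measurability.
  - by move=> x; rewrite mulr_ge0.
  rewrite !exponential_meanZ// ?exponential_mean1// ?exponential_mean_norm//.
  by rewrite mule1.
move=> /(sum_peak_weight_exp_ge _ _ e0).
have pe : expR (- (a + e) * D) <= p.
  by rewrite /p ler_expR mulNr lerN2 ler_wpM2r ?(ltW D_gt0)// lerDl ltW.
have Q0 : 0 < e + a * expR (- (a + e) * D) by rewrite addr_gt0// mulr_gt0// expR_gt0.
have ae0 : 0 < a + e by rewrite addr_gt0.
rewrite ler_pdivrMr ?mulr_gt0// => h.
have {h} : a <= c * (K * e + 1) * (a + e) * (e + a * expR (- (a + e) * D)).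
  rewrite -(ler_pM2l a_gt0) -expr2; apply: le_trans h _.
  by rewrite le_eqVlt; apply/orP; left; apply/eqP; field; rewrite gt_eqF.
move=> h; apply: (@le_trans _ _ (c * (K * e + 1) * (a + e) * (e + a * p))).
  apply: le_trans h _; apply: ler_wpM2l.
    by rewrite !mulr_ge0// ?addr_ge0// ?mulr_ge0// ltW.
  by rewrite lerD2l ler_wpM2l// ltW.
rewrite -subr_ge0.
have -> : c * a * (a * p) + e * B - c * (K * e + 1) * (a + e) * (e + a * p) =
  c * e * ((1 - e) + K * (a * (1 - e) + (1 - e) * (1 + e) + a * p * (1 - e))).
  by rewrite /B; ring.
have e1' : 0 <= 1 - e by rewrite subr_ge0.
have a0 := ltW a_gt0; have K0' := ltW K0; have e0' := ltW e0; have p0' := ltW p0.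
apply: mulr_ge0; first exact: mulr_ge0.
apply: addr_ge0 => //; apply: mulr_ge0 => //.
by apply: addr_ge0; [apply: addr_ge0|]; apply: mulr_ge0 => //;
  [exact: addr_ge0 | exact: mulr_ge0].
Qed.

End lower_bound.

Theorem theorem5 (R : realType) (lambda mu : R)
  (lambda_gt0 : 0 < lambda) (lambda_lt_mu : lambda < mu)
  (FS : probability (measurableTypeR R) R)
  (FS_ge0 : FS [set x | x < 0] = 0%E)
  (FS_mean : (\int[FS]_x x%:E = (mu^-1)%:E)%E)
  (dG : measure_display) (TG : measurableType dG) (PG : probability TG R)
  (genG serviceG : nat -> {RV PG >-> R}) (sigmaG : R -> TG -> option nat)
  (dD : measure_display) (TD : measurableType dD) (PD : probability TD R)
  (genD serviceD : nat -> {RV PD >-> R}) (sigmaD : R -> TD -> option nat) :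
  MG1_lcfsp lambda FS genG serviceG sigmaG ->
  MG1_lcfsp lambda (\d_(mu^-1)) genD serviceD sigmaD ->
  (average_age PG genG serviceG sigmaG <= average_age PD genD serviceD sigmaD)%E.
Proof.
move=> modelG modelD.
have D_gt0 : 0 < mu^-1 by rewrite invr_gt0 (lt_trans lambda_gt0).
apply: le_trans (average_age_lower _ _ _ _ _ _ lambda_gt0 D_gt0 modelD).
exact: (average_age_upper _ _ _ _ _ _ _ lambda_gt0 D_gt0 FS_ge0 FS_mean modelG).
Qed.
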